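(* Let $n\geq 4$. The number of $z$-classes in the alternating group $A_n$ is $$cl(A_n)-\bigl(q(n)+\tilde q(n-3)\bigr)+\epsilon(n),$$ where $cl(A_n)=\frac{p(n)+3q(n)}{2}$ is the number of conjugacy classes in $A_n$.
   Context: For a group $G$, two elements $x,y\in G$ are $z$-conjugate if their centralizers $\mathcal{Z}_G(x)$ and $\mathcal{Z}_G(y)$ are conjugate subgroups of $G$; the equivalence classes are called $z$-classes. $p(m)$ is the number of partitions of $m$; $q(m)$ is the number of partitions of $m$ with all parts distinct and odd; $\tilde q(m)$ is the number of partitions of $m$ with all parts distinct and odd and in which $1$ does not appear as a part; $\epsilon(m)$ is the number of partitions of $m$ with all parts distinct, odd and perfect squares. *)

(* Defs.v *)
From mathcomp Require Import all_boot all_fingroup all_solvable all_algebra.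

Set Implicit Arguments.
Unset Strict Implicit.
Unset Printing Implicit Defensive.

Section ZClasses.

Variable gT : finGroupType.
Implicit Types (G : {group gT}) (x y g : gT).

Local Open Scope group_scope.

Definition zconj G x y := [exists g in G, 'C_G[x] :^ g == 'C_G[y]].

Lemma zconj_equivalence G : {in G & &, equivalence_rel (zconj G)}.
Proof.
move=> x y z _ _ _; split=> [|/existsP[g /andP[Gg /eqP xy]]].
  by apply/existsP; exists 1; rewrite group1 conjsg1 eqxx.
apply/existsP/existsP=> -[h /andP[Gh /eqP xz]].
  by exists (g^-1 * h); rewrite groupM ?groupV // -xy -conjsgM mulKVg xz eqxx.
by exists (g * h); rewrite groupM // conjsgM xy xz eqxx.
Qed.

Definition zclasses G : {set {set gT}} := equivalence_partition (zconj G) G.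

End ZClasses.

Definition int_partition (m : nat) (s : seq nat) : bool :=
  [&& sorted geq s, 0 \notin s & sumn s == m].

(* A partition of [m] has at most [m] parts, each at most [m], so the partitions
   of [m] all live in the finite type [m.-bseq 'I_m.+1]. *)
Definition num_partitions (P : pred (seq nat)) (m : nat) : nat :=
  #|[set s : m.-bseq 'I_m.+1 |
      int_partition m (map val s) & P (map val s)]|.

Lemma int_partition_bseq m s : int_partition m s ->
  exists t : m.-bseq 'I_m.+1, map val t = s.
Proof.
case/and3P=> _ s0 /eqP sm.
have le_sm : all (fun k => k < m.+1) s.
  apply/allP=> k ks; rewrite ltnS -sm sumnE (big_rem k) //=; exact: leq_addr.
have le_sz : size s <= m.
  rewrite -sm; elim: s s0 {sm le_sm} => //= k s IHs.
  rewrite inE negb_or eq_sym -lt0n => /andP[k0 /IHs]; rewrite -add1n.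
  exact: leq_add.
have val_t : map val (map (@inord m) s) = s.
  rewrite -map_comp -[RHS]map_id; apply/eq_in_map=> k /(allP le_sm) km /=.
  exact: inordK.
have sz_t : size (map (@inord m) s) <= m by rewrite size_map.
by exists (Bseq sz_t).
Qed.

Definition perfect_square (k : nat) : bool := [exists i : 'I_k.+1, i ^ 2 == k].

Definition p : nat -> nat := num_partitions predT.

Definition q : nat -> nat := num_partitions (fun s => uniq s && all odd s).

Definition q_tilde : nat -> nat :=
  num_partitions (fun s => [&& uniq s, all odd s & 1 \notin s]).

Definition epsilon : nat -> nat :=
  num_partitions (fun s => [&& uniq s, all odd s & all perfect_square s]).

(* Main.v *)
Require Import Defs.
From mathcomp Require Import all_boot all_fingroup all_solvable all_algebra.
From mathcomp Require Import lra.

(** Let [A] be the alternating group, [G] the symmetric group, and [C x] the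
centralizer of [x] in [A] (it is [altC x] below).

Both counts rest on one principle for a subgroup of index two
([card_orbits_index2]): when [G] acts, the number of [A]-orbits is the number of
[G]-orbits plus the number of [G]-orbits with point stabilizers inside [A].

Conjugacy classes.  The centralizer of [x] in [G] lies in [A] exactly when the
cycle lengths of [x] are odd and distinct ([cent1_sub_Alt]).  Hence [A] has
[e + q n] classes, where [e] is the number of classes of [G] contained in [A].
Counting commuting pairs gives [p n + #|classes A| = 3 * e] ([classes_index2]), and
eliminating [e] yields the formula.

Classes of centralizers under [G].  The group [C x] almost determines the cycle type
of [x].  Group together the points that have the same orbit and the same stabilizer
under [C x].  Each cycle of [x] lies in one such group of points, and different
cycles usually lie in different groups, because suitable cycles of [x] and
combinations of them are even elements that fix one cycle and move another.  Merging
happens only in three situations: three fixed points, all other parts being odd and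
distinct; exactly two fixed points; two cycles of length two, all other parts being
odd and distinct.  In the last two cases the merging changes the parity of the number
of parts, so the evenness of [x] reveals that it took place, and the type is recovered
([cycle_type_altC]).  The first case is a true coincidence: for [mu] with distinct
odd parts different from [1], the types [1 + 1 + 1 + mu] and [3 + mu] give the same
centralizers ([exceptional_altC]).  There are [q_tilde (n - 3)] such [mu], so there
are [e - q_tilde (n - 3)] classes of subgroups [C x] under [G].

Classes of centralizers under [A].  By the principle above it remains to know when
the normalizer of [C x] lies in [A] ([norm_altC_sub_Alt]).  This forces the parts to
be distinct and odd.  Then the normalizer acts on each cycle, seen as [Z/l], by affine
maps [i |-> u * i + v], and every such map with [u] prime to [l] occurs.  The
translations are even, and the sign of the multiplication by [u] is the Jacobi symbol
[(u/l)], which is multiplicative in [l] ([scale_oddM]): it is always [1] when [l] is a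
square, and takes the value [-1] otherwise ([nonsquare_scale_odd]).  Hence [epsilon n]
classes split in two. *)

Set Implicit Arguments.
Unset Strict Implicit.
Unset Printing Implicit Defensive.

Local Open Scope group_scope.

(** * Orbits and classes under a subgroup of index two *)

Lemma card_imset_ker (aT rT rT' : finType) (f : aT -> rT) (g : aT -> rT')
    (A : {set aT}) :
  {in A &, forall x y, f x = f y <-> g x = g y} -> #|f @: A| = #|g @: A|.
Proof.
move=> fg; pose h x := (f x, g x).
have -> : f @: A = fst @: (h @: A) by rewrite -imset_comp; apply: eq_imset.
have -> : g @: A = snd @: (h @: A) by rewrite -imset_comp; apply: eq_imset.
rewrite (@card_in_imset _ _ fst) 1?(@card_in_imset _ _ snd) // => u v;
  move=> /imsetP[x Ax ->] /imsetP[y Ay ->] /= e;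
  by rewrite /h e; congr (_, _); apply/(fg x y).
Qed.

(** Burnside's count, kept as a sum over the points so that the sums for a group
and for a subgroup can be compared term by term. *)
Lemma sum_card_stab (aT : finGroupType) (rT : finType)
    (to : {action aT &-> rT}) (G : {group aT}) (A : {set rT}) :
  [acts G, on A | to] ->
  \sum_(w in A) #|'C_G[w | to]| = (#|orbit to G @: A| * #|G|)%N.
Proof.
move=> actGA; rewrite (set_partition_big _ (orbit_partition actGA)) -sum_nat_const.
apply: eq_bigr => _ /imsetP[w Aw ->].
rewrite -(card_orbit_stab to G w) -sum_nat_const.
apply: eq_bigr => v wv; have /orbit_eqP E := wv.
have O0 : 0 < #|orbit to G w| by apply/card_gt0P; exists v.
by apply/eqP; rewrite -(eqn_pmul2l O0) -{1}E !card_orbit_stab.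
Qed.

Lemma card_subgroup_index2 (gT : finGroupType) (G H K : {group gT}) :
  H <| G -> #|G : H| = 2 -> K \subset G -> ~~ (K \subset H) ->
  #|K| = (2 * #|K :&: H|)%N.
Proof.
move=> nHG iHG sKG nKH; rewrite -(LagrangeI K H) mulnC; congr (_ * _)%N.
have dvd : #|K : H| %| 2.
  have nHK := subset_trans sKG (normal_norm nHG).
  by rewrite -iHG -!card_quotient ?(normal_norm nHG) // cardSg ?quotientS.
have /primeP[_ /(_ _ dvd)] := (isT : prime 2).
by rewrite indexg_eq1 (negPf nKH) => /eqP.
Qed.

(** A [G]-orbit either stays an [H]-orbit or splits into two halves, and it splits
exactly when the point stabilizers lie in [H].  The proof compares the two
Burnside sums: the stabilizer of [w] in [H] has order [#|'C_G[w | to]|] or half of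
it according to the case. *)
Lemma card_orbits_index2 (aT : finGroupType) (rT : finType)
    (to : {action aT &-> rT}) (G H : {group aT}) (A : {set rT}) :
  H <| G -> #|G : H| = 2 -> [acts G, on A | to] ->
  #|orbit to H @: A| = (#|orbit to G @: A|
    + #|orbit to G @: [set w in A | 'C_G[w | to] \subset H]|)%N.
Proof.
move=> nHG iHG actG; have sHG := normal_sub nHG.
set B := [set w in A | _].
have actB : [acts G, on B | to].
  apply/actsP => g Gg w; rewrite !inE (actsP actG g Gg).
  suff -> : 'C_G[to w g | to] = 'C_G[w | to] :^ g.
    by rewrite -{1}(normsP (normal_norm nHG) g Gg) conjSg.
  by rewrite conjIg (conjGid Gg) -astab1_act.
have actH : [acts H, on A | to] := subset_trans sHG actG.
have oG : #|G| = (2 * #|H|)%N by rewrite -(Lagrange sHG) iHG mulnC.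
apply/eqP; rewrite -(eqn_pmul2r (cardG_gt0 G)) mulnDl -!sum_card_stab //.
rewrite oG mulnCA -sum_card_stab // big_distrr /=.
rewrite [X in _ == (_ + X)%N](_ : _ =
  \sum_(w in A) (if w \in B then #|'C_G[w | to]| else 0))%N.
  rewrite -big_split /=; apply/eqP/eq_bigr => w Aw; rewrite inE Aw /=.
  have -> : 'C_H[w | to] = 'C_G[w | to] :&: H.
    by rewrite setIAC (setIidPr sHG).
  case: ifPn => [sCH | nCH]; first by rewrite (setIidPl sCH) addnn mul2n.
  by rewrite addn0 -(card_subgroup_index2 nHG) // subsetIl.
rewrite -big_mkcondr /=; apply: eq_bigl => w; rewrite !inE.
by case: (w \in A).
Qed.

(** A count of commuting pairs.  With [D] the complement of [H] in [G], there are
as many commuting pairs in [D * H] as in [H * D], and, for [x] in [D], as many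
elements commuting with [x] in [D] as in [H]; so the number of commuting pairs in
[G * G] is that for [H * H] plus three times that for [H * D].  The pairs in
[H * G] are counted by the [G]-classes contained in [H]. *)
Lemma classes_index2 (gT : finGroupType) (G H : {group gT}) :
  H <| G -> #|G : H| = 2 ->
  (#|classes G| + #|classes H| = 3 * #|class^~ G @: H|)%N.
Proof.
move=> nHG iHG; have sHG := normal_sub nHG.
have oG : #|G| = (2 * #|H|)%N by rewrite -(Lagrange sHG) iHG mulnC.
have acts : forall K : {group gT}, K \subset G -> [acts K, on H | 'J].
  move=> K sKG; apply/actsP => g Kg x.
  by rewrite /= memJ_norm // (subsetP (normal_norm nHG)) ?(subsetP sKG).
have actGG : [acts G, on G | 'J] by apply/actsP => g Gg x; rewrite /= groupJr.
have cHG : \sum_(x in H) #|'C_G[x]| = (#|class^~ G @: H| * #|G|)%N.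
  rewrite -sum_card_stab ?acts //; apply: eq_bigr => x _; by rewrite astab1J.
have cHH : \sum_(x in H) #|'C_H[x]| = (#|classes H| * #|H|)%N.
  rewrite -sum_card_stab ?acts //; apply: eq_bigr => x _; by rewrite astab1J.
have cGG : \sum_(x in G) #|'C_G[x]| = (#|classes G| * #|G|)%N.
  rewrite -sum_card_stab //; apply: eq_bigr => x _; by rewrite astab1J.
have cGH : \sum_(x in G) #|'C_H[x]| = (#|class^~ G @: H| * #|G|)%N.
  rewrite -cHG; under eq_bigr do rewrite -sum1_card.
  under [RHS]eq_bigr do rewrite -sum1_card.
  rewrite (exchange_big_dep (mem H)) /= => [|x y _]; last by case/setIP.
  apply: eq_bigr => y Hy; apply: eq_bigl => x.
  by rewrite !in_setI Hy cent1C.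
have cD : (\sum_(x in G :\: H) #|'C_G[x]| = 2 * \sum_(x in G :\: H) #|'C_H[x]|)%N.
  rewrite big_distrr; apply: eq_bigr => x /setDP[Gx nHx] /=.
  have -> : 'C_H[x] = 'C_G[x] :&: H by rewrite setIAC (setIidPr sHG).
  rewrite -(card_subgroup_index2 nHG) ?subsetIl //.
  by apply/subsetPn; exists x; rewrite // inE Gx cent1id.
have split F : (\sum_(x in G) F x = \sum_(x in H) F x + \sum_(x in G :\: H) F x)%N.
  by rewrite (big_setID H) /= (setIidPr sHG).
have cHG2 : (#|classes H| * #|G| = 2 * \sum_(x in H) #|'C_H[x]|)%N.
  by rewrite cHH oG mulnCA.
apply/eqP; rewrite -(eqn_pmul2r (cardG_gt0 G)) mulnDl -cGG split cD cHG2.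
by rewrite -addnA -mulnDr addnC [X in (2 * X)%N]addnC -split cGH cHG -mulSnr mulnA.
Qed.

(** * Cycles and commuting permutations *)

Lemma cent1_permP (T : finType) (x g : {perm T}) :
  reflect (forall z, g (x z) = x (g z)) (g \in 'C[x]).
Proof.
apply: (iffP cent1P) => [gx z | gx]; first by rewrite -!permM gx.
by apply/permP=> z; rewrite !permM gx.
Qed.

Lemma mem_porbits (T : finType) (x : {perm T}) a : porbit x a \in porbits x.
Proof. exact: imset_f. Qed.

Lemma porbit_eq (T : finType) (x : {perm T}) a b :
  b \in porbit x a -> porbit x b = porbit x a.
Proof. by rewrite -eq_porbit_mem => /eqP. Qed.

Lemma porbitsP (T : finType) (x : {perm T}) (O : {set T}) z :
  O \in porbits x -> z \in O -> O = porbit x z.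
Proof. by case/imsetP=> a _ -> /porbit_eq. Qed.

(** The powers of [x] act on the cycle through [a] as residues modulo its length. *)
Lemma expg_permE (T : finType) (x : {perm T}) (i j : nat) a :
  ((x ^+ i) a == (x ^+ j) a) = (i == j %[mod #|porbit x a|]).
Proof.
set l := #|porbit x a|; have l0 : 0 < l by rewrite lt0n card_porbit_neq0.
have red k : (x ^+ k) a = (x ^+ (k %% l)) a.
  rewrite {1}(divn_eq k l) expgD permM mulnC expgM (permX_fix (s := x ^+ l)) //.
  by rewrite permX iter_porbit.
have nt k : k < l -> (x ^+ k) a = nth a (traject x a l) k.
  by move=> lt_kl; rewrite nth_traject // permX.
by rewrite red (red j) !nt ?ltn_mod // nth_uniq ?size_traject ?ltn_mod
  ?uniq_traject_porbit.
Qed.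

Lemma expg_permC (T : finType) (x y g : {perm T}) :
  (forall z, g (x z) = y (g z)) ->
  forall i z, g ((x ^+ i) z) = (y ^+ i) (g z).
Proof.
by move=> gxy; elim=> [|i IHi] z; rewrite ?perm1 // !expgSr !permM gxy IHi.
Qed.

Lemma porbit_intertwine (T : finType) (x y g : {perm T}) :
  (forall z, g (x z) = y (g z)) -> forall z, porbit y (g z) = g @: porbit x z.
Proof.
move=> gxy z; apply/setP=> u; apply/porbitP/imsetP=> [[i ->] | [_ /porbitP[i ->] ->]].
  by exists ((x ^+ i) z); rewrite ?mem_porbit // (expg_permC gxy).
by exists i; rewrite (expg_permC gxy).
Qed.

(** The common source of conjugating elements and of elements of centralizers: a
permutation [g] with [g x = y g] may be prescribed freely on one base point [s O]
of each cycle [O] of [x], as long as distinct cycles go to distinct cycles of the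
same length. *)
Lemma intertwiner (T : finType) (x y : {perm T}) (s t : {set T} -> T) :
    (forall O, O \in porbits x -> s O \in O) ->
    (forall O, O \in porbits x -> #|porbit y (t O)| = #|O|) ->
    {in porbits x &, injective (fun O => porbit y (t O))} ->
  exists g : {perm T}, (forall z, g (x z) = y (g z))
    /\ {in porbits x, forall O, g (s O) = t O}.
Proof.
move=> sO cardO injO.
pose O z := porbit x z; have xO z : O z \in porbits x by apply: mem_porbits.
have xs z : O (s (O z)) = O z by apply: porbit_eq; apply: sO.
pose k z := index z (traject x (s (O z)) #|O z|).
pose f z := (y ^+ k z) (t (O z)).
have zE z : z = (x ^+ k z) (s (O z)).
  have zt : z \in traject x (s (O z)) #|O z|.
    by rewrite -{2}xs -porbit_traject -/(O _) xs porbit_id.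
  have lt_k : k z < #|O z|.
    by have := zt; rewrite -index_mem size_traject.
  by rewrite permX -(nth_traject x lt_k) nth_index.
have cO z : #|porbit x (s (O z))| = #|O z| by rewrite -/(O _) xs.
have fE i z : f ((x ^+ i) (s (O z))) = (y ^+ i) (t (O z)).
  set u := (x ^+ i) _; have Ou : O u = O z by rewrite /O porbit_perm.
  apply/eqP; rewrite /f Ou expg_permE cardO // -cO -expg_permE.
  by have := zE u; rewrite Ou => <-.
have f_inj : injective f.
  move=> z1 z2 e12.
  have O12 : O z1 = O z2.
    apply: injO; rewrite //= -(porbit_perm _ (k z1)) -[in RHS](porbit_perm _ (k z2)).
    by congr porbit.
  move/eqP: e12; rewrite /f O12 expg_permE cardO // -cO -expg_permE.
  move/eqP=> e12; by rewrite [z1]zE [z2]zE O12.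
exists (perm f_inj); split=> [z | X /imsetP[z _ ->]]; rewrite !permE; last first.
  by have := fE 0 z; rewrite !perm1.
by rewrite {1}[z]zE -permM -expgSr fE expgSr permM.
Qed.

Lemma odd_perm_cycle (T : finType) (g : {perm T}) a :
  (forall z, z \notin porbit g a -> g z = z) -> g = ~~ odd #|porbit g a| :> bool.
Proof.
move=> gfix; set O := porbit g a.
have fixO z : z \notin O -> porbit g z = [set z].
  move=> nOz; apply/setP=> u; rewrite inE; apply/porbitP/eqP=> [[i ->] | ->].
    by rewrite permX_fix ?gfix.
  by exists 0; rewrite perm1.
have -> : odd_perm g = odd #|T| (+) odd #|porbits g| by [].
have -> : porbits g = O |: (set1 @: ~: O).
  apply/setP=> X; rewrite in_setU1; apply/imsetP/predU1P.
    case=> z _ ->; case: (boolP (z \in O)) => [/porbit_eq ->|nOz]; first by left.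
    by right; rewrite fixO // imset_f ?inE.
  case=> [-> | /imsetP[z]]; first by exists a.
  by rewrite inE => nOz ->; exists z; rewrite ?fixO.
rewrite cardsU1 card_imset; last exact: set1_inj.
have -> : O \notin [set [set x] | x in ~: O].
  apply/imsetP=> -[z]; rewrite inE => nOz OE.
  by case/negP: nOz; rewrite OE set11.
by rewrite -(cardsC O) !oddD; case: (odd _); case: (odd _).
Qed.

(** Two cycles of the same length [l] can be interleaved into one cycle of length
[2 * l], whose square is [x] on both of them.  Such a cycle is odd whatever the
parity of [l], whereas exchanging the two cycles is odd only for odd [l]. *)
Lemma odd_cent1_merge (T : finType) (x : {perm T}) a b :
    porbit x a != porbit x b -> #|porbit x a| = #|porbit x b| ->
  exists d : {perm T}, [/\ d \in 'C[x], odd_perm d, d a = b, d b = x a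
    & forall z, z \notin porbit x a -> z \notin porbit x b -> d z = z].
Proof.
set A := porbit x a; set B := porbit x b => neAB cardAB.
pose e (O : {set T}) := odflt a [pick z in O].
pose s O := if O == A then a else if O == B then b else e O.
pose t O := if O == A then b else if O == B then x a else e O.
have eO O : O \in porbits x -> e O \in O.
  case/imsetP=> z _ ->; rewrite /e; case: pickP => //= /(_ z).
  by rewrite porbit_id.
have tO O : porbit x (t O) =
    if O == A then B else if O == B then A else porbit x (e O).
  rewrite /t; do 2?[case: ifP] => // _ _.
  by apply: porbit_eq; rewrite -[x a]/((x ^+ 1) a) mem_porbit.
have [|O xO|O P xO xP|d [dx dst]] := @intertwiner T x x s t.
- move=> O xO; rewrite /s.
  by case: eqP => [->|_]; [|case: eqP => [->|_]]; rewrite ?porbit_id ?eO.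
- rewrite tO; case: eqP => [->|_]; last case: eqP => [->|_] //.
  + by [].
  + by rewrite -(porbitsP xO (eO _ xO)).
- have eE Q : Q \in porbits x -> porbit x (e Q) = Q.
    by move=> xQ; rewrite -(porbitsP xQ (eO _ xQ)).
  rewrite !tO !eE //.
  case: (eqVneq O A) => [->|nOA]; last case: (eqVneq O B) => [->|nOB];
  (case: (eqVneq P A) => [->|nPA]; last case: (eqVneq P B) => [->|nPB]) => //;
  by move/eqP; rewrite // eq_sym ?(negPf neAB) ?(negPf nOA) ?(negPf nOB)
    ?(negPf nPA) ?(negPf nPB) // eq_sym ?(negPf neAB) ?(negPf nOA) ?(negPf nOB)
    ?(negPf nPA) ?(negPf nPB).
have da : d a = b by have := dst A (mem_porbits x a); rewrite /s /t eqxx.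
have db : d b = x a.
  by have := dst B (mem_porbits x b); rewrite /s /t eq_sym (negPf neAB) eqxx.
have dfix z : z \notin A -> z \notin B -> d z = z.
  move=> nAz nBz; have := dst (porbit x z) (mem_porbits x z).
  have nA : porbit x z == A = false by apply: contraNF nAz; rewrite eq_porbit_mem.
  have nB : porbit x z == B = false by apply: contraNF nBz; rewrite eq_porbit_mem.
  rewrite /s /t nA nB => de; have /porbitP[i zE] : z \in porbit x (e (porbit x z)).
    by rewrite -(porbitsP _ (eO _ _)) ?mem_porbits ?porbit_id.
  by rewrite zE (expg_permC dx) de.
have dO : porbit d a = A :|: B.
  apply/setP=> z; rewrite inE; apply/porbitP/orP => [[i ->{z}] | ].
    apply/orP; elim: i => [|i]; first by rewrite perm1 porbit_id.
    rewrite expgSr permM => /orP[] /porbitP[j ->]; rewrite (expg_permC dx) ?da ?db.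
      by rewrite mem_porbit orbT.
    by rewrite -permM -expgS mem_porbit.
  (* Even powers of [d] run through the cycle of [a], odd ones through that of [b]. *)
  have d2 i : (d ^+ (2 * i)) a = (x ^+ i) a.
    elim: i => [|i IHi]; first by rewrite muln0 !perm1.
    by rewrite mulnS addnC expgD permM IHi !permM !(expg_permC dx) da db -permM -expgS.
  case=> /porbitP[i ->]; first by exists (2 * i)%N; rewrite d2.
  by exists (2 * i).+1; rewrite expgSr permM d2 (expg_permC dx) da.
exists d; split=> //; first by apply/cent1_permP.
rewrite (odd_perm_cycle (a := a)) ?dO => [|z]; last first.
  by rewrite inE negb_or => /andP[]; apply: dfix.
rewrite cardsU (_ : A :&: B = set0) ?cards0 ?subn0 ?cardAB ?addnn ?odd_double //.
apply/eqP/set0Pn=> -[z /setIP[Az Bz]]; case/negP: neAB.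
by rewrite /A /B -(porbit_eq Az) -(porbit_eq Bz).
Qed.

Lemma cent1_restr_porbit (T : finType) (x : {perm T}) a :
  exists d : {perm T}, [/\ d \in 'C[x], d = ~~ odd #|porbit x a| :> bool,
    {in porbit x a, d =1 x} & forall z, z \notin porbit x a -> d z = z].
Proof.
set A := porbit x a.
have nA : x \in 'N(A | 'P).
  apply/astabsP=> z; rewrite /= -[aperm z x]/((x ^+ 1) z).
  by rewrite -!eq_porbit_mem porbit_perm.
have dA : {in A, restr_perm A x =1 x} by move=> z Az; apply: restr_permE.
have dfix z : z \notin A -> restr_perm A x z = z.
  by apply: out_perm; apply: restr_perm_on.
have dO : porbit (restr_perm A x) a = A.
  have e i : (restr_perm A x ^+ i) a = (x ^+ i) a.
    by elim: i => // i IHi; rewrite !expgSr !permM IHi dA ?mem_porbit.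
  by apply/setP=> z; apply/porbitP/porbitP=> -[i ->]; exists i; rewrite e.
exists (restr_perm A x); split=> //; last first.
  by rewrite (odd_perm_cycle (a := a)) dO.
by apply/cent1P/restr_perm_commute.
Qed.

(** * Cycle types *)

(** Listing the cycles themselves, and not only their lengths, in decreasing order
of length provides the matching of cycles between permutations of equal type. *)
Definition sorted_porbits (T : finType) (x : {perm T}) : seq {set T} :=
  sort (fun O P : {set T} => #|O| >= #|P|) (enum (porbits x)).

Definition cycle_type (T : finType) (x : {perm T}) : seq nat :=
  [seq #|A| | A : {set T} <- sorted_porbits x].

Lemma perm_sorted_porbits (T : finType) (x : {perm T}) :
  perm_eq (sorted_porbits x) (enum (porbits x)).
Proof. by rewrite perm_sort. Qed.

Lemma mem_sorted_porbits (T : finType) (x : {perm T}) :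
  sorted_porbits x =i porbits x.
Proof. by move=> O; rewrite mem_sort mem_enum. Qed.

Lemma uniq_sorted_porbits (T : finType) (x : {perm T}) : uniq (sorted_porbits x).
Proof. by rewrite sort_uniq enum_uniq. Qed.

Lemma sorted_cycle_type (T : finType) (x : {perm T}) : sorted geq (cycle_type x).
Proof. by rewrite sorted_map sort_sorted // => O P; apply: leq_total. Qed.

Lemma size_cycle_type (T : finType) (x : {perm T}) :
  size (cycle_type x) = #|porbits x|.
Proof. by rewrite size_map size_sort cardE. Qed.

Lemma sorted_geq_eq (s t : seq nat) :
  sorted geq s -> sorted geq t -> perm_eq s t -> s = t.
Proof.
apply: sorted_eq => [i j k|i j]; first by move=> h1 h2; apply: leq_trans h2 h1.
by move=> h; apply/eqP; rewrite eqn_leq andbC; exact: h.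
Qed.

Lemma cycle_type_perm (T : finType) (x : {perm T}) (P : seq {set T}) :
  uniq P -> P =i porbits x -> perm_eq (cycle_type x) [seq #|A| | A : {set T} <- P].
Proof.
move=> uP eP; apply/perm_map/uniq_perm; rewrite ?uniq_sorted_porbits //.
by move=> O; rewrite mem_sorted_porbits eP.
Qed.

Lemma mem_cycle_type (T : finType) (x : {perm T}) z :
  #|porbit x z| \in cycle_type x.
Proof. by apply: map_f; rewrite mem_sorted_porbits mem_porbits. Qed.

Lemma cycle_typeP (T : finType) (x : {perm T}) k :
  reflect (exists z, k = #|porbit x z|) (k \in cycle_type x).
Proof.
apply: (iffP mapP) => [[O] | [z ->]]; last first.
  by exists (porbit x z); rewrite ?mem_sorted_porbits ?mem_porbits.
by rewrite mem_sorted_porbits => /imsetP[z _ ->] ->; exists z.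
Qed.

Lemma uniq_cycle_typeP (T : finType) (x : {perm T}) :
  reflect (forall a b, #|porbit x a| = #|porbit x b| -> porbit x a = porbit x b)
    (uniq (cycle_type x)).
Proof.
have -> : uniq (cycle_type x) = dinjectiveb (fun O : {set T} => #|O|) (mem (porbits x)).
  apply: perm_uniq; exact/perm_map/perm_sorted_porbits.
apply: (iffP (dinjectiveP _ _)) => [inj a b | inj _ _ /imsetP[a _ ->] /imsetP[b _ ->]].
  by apply: inj; apply: mem_porbits.
exact: inj.
Qed.

Lemma cycle_type_intertwine (T : finType) (x y g : {perm T}) :
  (forall z, g (x z) = y (g z)) -> cycle_type x = cycle_type y.
Proof.
move=> gxy; apply: sorted_geq_eq; rewrite ?sorted_cycle_type // perm_sym.
have gi : injective (fun O : {set T} => g @: O) by apply/imset_inj/perm_inj.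
have -> : cycle_type x =
    [seq #|A| | A : {set T} <- [seq g @: A | A : {set T} <- sorted_porbits x]].
  by rewrite -map_comp; apply: eq_map => O /=; rewrite card_imset //; apply: perm_inj.
apply: cycle_type_perm; first by rewrite map_inj_uniq ?uniq_sorted_porbits.
move=> O; apply/mapP/imsetP => [[P] | [z _ ->]].
  rewrite mem_sorted_porbits => /imsetP[z _ ->] ->.
  by exists (g z); rewrite ?(porbit_intertwine gxy).
exists (porbit x (g^-1 z)); first by rewrite mem_sorted_porbits mem_porbits.
by rewrite -(porbit_intertwine gxy) permKV.
Qed.

Lemma cycle_typeJ (T : finType) (x g : {perm T}) : cycle_type (x ^ g) = cycle_type x.
Proof.
by symmetry; apply: (@cycle_type_intertwine _ _ _ g) => z; rewrite permJ.
Qed.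

(** Cycles at the same rank in the two sorted lists have the same length. *)
Lemma cycle_type_conj (T : finType) (x y : {perm T}) :
  cycle_type x = cycle_type y -> exists g, y = x ^ g.
Proof.
move=> ctxy; pose S := sorted_porbits x; pose S' := sorted_porbits y.
have szS : size S = size S'.
  by rewrite -(size_map (fun O : {set T} => #|O|)) -/(cycle_type x) ctxy size_map.
pose next O := nth set0 S' (index O S).
have lt_ix O : O \in porbits x -> index O S < size S'.
  by rewrite -szS index_mem mem_sorted_porbits.
have yn O : O \in porbits x -> next O \in porbits y.
  by move/lt_ix=> lt; rewrite -mem_sorted_porbits mem_nth.
have cn O : O \in porbits x -> #|next O| = #|O|.
  move=> xO; rewrite /next -(nth_map _ 0 (fun O : {set T} => #|O|)) ?lt_ix //.
  rewrite -[map _ _]/(cycle_type y) -ctxy (nth_map set0) ?szS ?lt_ix //.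
  by rewrite nth_index // mem_sorted_porbits.
have ni : {in porbits x &, injective next}.
  move=> O P xO xP /eqP; rewrite nth_uniq ?lt_ix ?uniq_sorted_porbits // => /eqP e.
  rewrite -[O](nth_index set0 (s := S)) ?mem_sorted_porbits // e.
  by rewrite nth_index ?mem_sorted_porbits.
have [T0 | /card_gt0P[a0 _]] := posnP #|T|.
  by exists 1; apply/permP=> z; have := fintype0 z T0.
have [s Hs] : exists s : {set T} -> T, forall y O, O \in porbits y -> s O \in O.
  exists (fun O : {set T} => odflt a0 [pick z in O]) => u _ /imsetP[z _ ->].
  by case: pickP => //= /(_ z); rewrite porbit_id.
have yt O : O \in porbits x -> porbit y (s (next O)) = next O.
  by move=> xO; rewrite -(porbitsP (yn O xO)) // (Hs y) ?yn.
have [||O P xO xP|g [gxy _]] := @intertwiner T x y s (fun O => s (next O)).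
- exact: Hs.
- by move=> O xO; rewrite yt ?cn.
- by rewrite !yt //; apply: ni.
exists g; apply/permP=> z; rewrite -[z](permKV g) permJ.
by rewrite gxy.
Qed.

Lemma cycle_type_eqP (T : finType) (x y : {perm T}) :
  cycle_type x = cycle_type y <-> exists g, y = x ^ g.
Proof. by split=> [/cycle_type_conj //|[g ->]]; rewrite cycle_typeJ. Qed.

Lemma cycle_type_partition (T : finType) (x : {perm T}) :
  int_partition #|T| (cycle_type x).
Proof.
apply/and3P; split; first exact: sorted_cycle_type.
  by apply/cycle_typeP=> -[z /esym/eqP]; rewrite (negPf (card_porbit_neq0 _ _)).
rewrite sumnE (perm_big _ (perm_map _ (perm_sorted_porbits x))) /= big_map big_enum /=.
apply/eqP; rewrite -sum1_card (partition_big_imset (porbit x)) /=.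
apply: eq_bigr => O /imsetP[a _ ->]; rewrite -sum1_card; apply: eq_bigl => z.
by rewrite eq_porbit_mem.
Qed.

(** Every partition of the points, given by the fibres of a function, is the cycle
partition of some permutation: rotate the enumeration of each fibre. *)
Lemma exists_porbits (T : finType) (I : eqType) (f : T -> I) :
  exists x : {perm T}, forall z, porbit x z = [set u | f u == f z].
Proof.
pose c z := enum [set u | f u == f z].
have uc z : uniq (c z) by apply: enum_uniq.
have zc u z : (u \in c z) = (f u == f z) by rewrite mem_enum inE.
pose n z := next (c z) z.
have fn z : f (n z) = f z by apply/eqP; rewrite -zc mem_next zc.
have cE u z : f u = f z -> c u = c z by move=> e; rewrite /c e.
have n_inj : injective n.
  move=> u z e; have fe : f u = f z by rewrite -fn e fn.
  have := e; rewrite /n (cE _ _ fe) => e'.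
  by rewrite -(prev_next (uc z) u) e' prev_next.
exists (perm n_inj) => z; apply/setP=> u; rewrite inE -zc.
have cyc : fcycle n (c z).
  apply: (sub_in_cycle (P := mem (c z)) (e := [rel p q | next (c z) p == q])).
  - by move=> p q; rewrite !zc /= /n => /eqP/cE-> _.
  - by apply/allP.
  exact: cycle_next.
have zz : z \in c z by rewrite zc.
rewrite -(fconnect_cycle cyc zz u).
apply/porbitP/idP => [[i ->] | /iter_findex <-].
  by rewrite permX (eq_iter (permE n_inj)) fconnect_iter.
by exists (findex n z u); rewrite permX (eq_iter (permE n_inj)).
Qed.

(** * Partitions as cycle types *)

(** Label the points so that label [r] is used [nth 0 s r] times, and take a
permutation whose cycles are the classes of equally labelled points. *)
Lemma exists_cycle_type n (s : seq nat) :
  int_partition n s -> exists x : {perm 'I_n}, cycle_type x = s.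
Proof.
case/and3P=> sorted_s s0 /eqP sum_s.
pose ms := flatten [seq nseq (nth 0 s r) r | r <- iota 0 (size s)].
have sz_ms : size ms = n.
  rewrite size_flatten /shape -map_comp -sum_s; congr sumn.
  rewrite -[RHS](mkseq_nth 0) /mkseq; apply: eq_map => r /=; exact: size_nseq.
have count_ms r : r < size s -> count_mem r ms = nth 0 s r.
  move=> lt_r; rewrite count_flatten -map_comp sumnE big_map.
  rewrite (bigD1_seq r) ?mem_iota ?iota_uniq //= count_nseq /= eqxx mul1n.
  rewrite big1 ?addn0 // => i /negPf ne_ir.
  by rewrite count_nseq /= ne_ir.
pose f (z : 'I_n) := nth 0 ms z.
have fiber r : #|[set u | f u == r]| = count_mem r ms.
  rewrite -[ms in RHS](mkseq_nth 0) /mkseq sz_ms -val_enum_ord -map_comp count_map.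
  by rewrite cardsE cardE size_filter enumT.
have lt_f z : f z < size s.
  have: f z \in ms by rewrite mem_nth ?sz_ms.
  case/flattenP=> _ /mapP[r r_s ->]; rewrite mem_nseq => /andP[_ /eqP->].
  by move: r_s; rewrite mem_iota.
have [x xE] := exists_porbits f; exists x.
apply: sorted_geq_eq => //; first exact: sorted_cycle_type.
have -> : s = [seq #|A| | A : {set 'I_n}
                          <- [seq [set u | f u == r] | r <- iota 0 (size s)]].
  rewrite -map_comp -[LHS](mkseq_nth 0) /mkseq; apply/eq_in_map => r.
  by rewrite mem_iota /= => lt_r; rewrite fiber count_ms.
have pre r : r < size s -> exists z, f z = r.
  move=> lt_r; have : 0 < #|[set u | f u == r]|.
    rewrite fiber count_ms // lt0n; apply: contraNneq s0 => <-; exact: mem_nth.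
  by case/card_gt0P=> z; rewrite inE => /eqP; exists z.
apply: cycle_type_perm.
  rewrite map_inj_in_uniq ?iota_uniq // => r r' /[!mem_iota] /= /pre[z <-] _.
  by move/setP/(_ z); rewrite !inE eqxx => /esym/eqP.
move=> O; apply/mapP/imsetP => [[r] | [z _ ->]].
  by rewrite mem_iota => /pre[z <-] ->; exists z; rewrite ?xE.
by exists (f z); rewrite ?xE // mem_iota /=.
Qed.

Definition partition_bseq m (s : seq nat) : m.-bseq 'I_m.+1 :=
  insub_bseq m (map inord s).

Lemma partition_bseqK m s :
  int_partition m s -> map val (partition_bseq m s) = s.
Proof.
move/int_partition_bseq=> [t <-]; congr map.
rewrite /partition_bseq -map_comp (eq_map (g := id)) ?map_id; last first.
  by move=> i /=; apply: inord_val.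
by rewrite val_insubd size_bseq.
Qed.

Lemma val_partition_bseq m (t : m.-bseq 'I_m.+1) :
  partition_bseq m (map val t) = t.
Proof.
apply: val_inj; rewrite /partition_bseq -map_comp (eq_map (g := id)) ?map_id.
  by rewrite val_insubd size_bseq.
by move=> i /=; apply: inord_val.
Qed.

(** The bridge between conjugacy in the symmetric group and partitions: anything
that separates the permutations of [A] exactly as their cycle type does takes as
many values on [A] as there are partitions satisfying [P]. *)
Lemma card_imset_cycle_type n (rT : finType) (P : pred (seq nat))
    (A : {set {perm 'I_n}}) (g : {perm 'I_n} -> rT) :
    (forall x, (x \in A) = P (cycle_type x)) ->
    {in A &, forall x y, g x = g y <-> cycle_type x = cycle_type y} ->
  #|g @: A| = num_partitions P n.
Proof.
move=> AP gct; have ctK (x : {perm 'I_n}) := partition_bseqK (cycle_type_partition x).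
rewrite card_ord in ctK.
rewrite (card_imset_ker (g := fun x => partition_bseq n (cycle_type x))).
  apply: eq_card => t; rewrite inE; apply/imsetP/andP=> [[x] | [tn Pt]].
    rewrite AP => Px ->; rewrite ctK; split=> //.
    by have := cycle_type_partition x; rewrite card_ord.
  have [x xt] := exists_cycle_type tn.
  by exists x; [rewrite AP xt | rewrite xt val_partition_bseq].
move=> x y Ax Ay; split=> [/gct-> // | e].
by apply/gct; rewrite // -ctK e ctK.
Qed.

Lemma eq_num_partitions (P Q : pred (seq nat)) n :
  {in int_partition n, P =1 Q} -> num_partitions P n = num_partitions Q n.
Proof.
move=> PQ; apply: eq_card => s; rewrite !inE.
by case: (boolP (int_partition _ _)) => //= /PQ.
Qed.

Lemma num_partitionsID (S P : pred (seq nat)) n :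
  num_partitions P n = (num_partitions (predI P S) n
    + num_partitions (predI P (predC S)) n)%N.
Proof.
rewrite /num_partitions -(cardsID [set s : n.-bseq _ | S (map val s)]).
by congr (_ + _)%N; apply: eq_card => s; rewrite !inE /=; case: (S _);
  rewrite ?andbT ?andbF.
Qed.

(** The types [1 + 1 + 1 + mu] where the parts of [mu] are odd, distinct and
different from [1].  These are the types of even permutations whose centralizer in
the alternating group also arises from another type, namely [3 + mu]. *)
Definition exceptional (s : seq nat) : bool :=
  [&& all odd s, count_mem 1%N s == 3 & uniq (filter (predC1 1%N) s)].

Lemma num_partitions_exceptional m :
  num_partitions exceptional (m + 3) = q_tilde m.
Proof.
pose ones := [:: 1; 1; 1]%N.
have geq_tr : transitive geq by move=> i j k h1 h2; apply: leq_trans h2 h1.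
have add_sorted s : 0 \notin s -> sorted geq s -> sorted geq (s ++ ones).
  move=> s0; rewrite !sorted_pairwise // pairwise_cat => -> /=; rewrite !andbT.
  apply/allP=> k ks; have k0 : 0 < k by rewrite lt0n; apply: contraNneq s0 => <-.
  by rewrite /= k0.
have add_int s : int_partition m s -> int_partition (m + 3) (s ++ ones).
  case/and3P=> ss s0 /eqP sm; rewrite /int_partition add_sorted //= sumn_cat sm.
  by rewrite mem_cat negb_or s0 eqxx.
pose h (t : m.-bseq 'I_m.+1) := partition_bseq (m + 3) (map val t ++ ones).
rewrite /q_tilde /num_partitions -[RHS](card_in_imset (f := h)); last first.
  move=> t u; rewrite !inE => /andP[tm _] /andP[um _].
  move/(congr1 (fun v : bseq_of _ _ => map val v)); rewrite !partition_bseqK ?add_int //.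
  move=> e; apply/val_inj/(inj_map val_inj)/eqP.
  have sz : size (map val t) = size (map val u).
    by have := congr1 size e; rewrite !size_cat => /addIn.
  by move/eqP: e; rewrite eqseq_cat // => /andP[].
apply: eq_card => t; rewrite inE; apply/andP/imsetP => [[tm] | [u]]; last first.
  rewrite inE => /andP[um /and3P[uniq_u odd_u u1]] ->.
  rewrite partition_bseqK ?add_int //; split=> //; apply/and3P; split.
  - by rewrite all_cat odd_u.
  - by rewrite count_cat (count_memPn u1).
  by rewrite filter_cat /= cats0 filter_uniq.
case/and3P=> odd_t /eqP t1 uniq_t; pose s := filter (predC1 1%N) (map val t).
have [t_sorted t0 /eqP t_sum] := and3P tm.
have s0 : 0 \notin s by rewrite mem_filter negb_and t0 orbT.
have s_sorted : sorted geq s by apply: sorted_filter.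
have tE : map val t = s ++ ones.
  apply: sorted_geq_eq; rewrite ?add_sorted // -(perm_filterC (predC1 1%N)).
  rewrite perm_cat2l (_ : filter _ _ = ones) //.
  have /all_pred1P -> : all (pred1 1%N) (filter (predC (predC1 1%N)) (map val t)).
    by apply/allP=> k; rewrite mem_filter /= negbK => /andP[].
  rewrite size_filter (eq_count (a2 := pred1 1%N)) ?t1 // => k /=.
  by rewrite negbK.
have sm : int_partition m s.
  apply/and3P; split=> //; move: t_sum; rewrite tE sumn_cat => /eqP.
  by rewrite eqn_add2r.
exists (partition_bseq m s); last by rewrite /h partition_bseqK // -tE val_partition_bseq.
rewrite inE partition_bseqK // sm; apply/and4P; split=> //.
  by apply/allP=> k; rewrite mem_filter => /andP[_]; apply: allP.
by rewrite mem_filter /=.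
Qed.

(** * Signs of commuting permutations *)

Lemma odd_permX (T : finType) (h : {perm T}) m :
  h ^+ m = odd m && h :> bool.
Proof.
by elim: m => [|m IHm]; rewrite ?odd_perm1 // expgS odd_permM IHm /=;
  case: (odd m); case: (odd_perm h).
Qed.

Lemma odd_perm_cycle_type (T : finType) (x : {perm T}) :
  x = odd #|T| (+) odd (size (cycle_type x)) :> bool.
Proof. by rewrite size_cycle_type. Qed.

Lemma cent1_porbit_card (T : finType) (x h : {perm T}) z :
  h \in 'C[x] -> #|porbit x (h z)| = #|porbit x z|.
Proof.
by move/cent1_permP=> hx; rewrite (porbit_intertwine hx) card_imset //; apply: perm_inj.
Qed.

(** On each cycle [h] acts as a power of [x], so that the product of the cycle
lengths, which is odd, kills [h]; an element of odd order is even. *)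
Lemma even_cent1_porbits (T : finType) (x h : {perm T}) :
    all odd (cycle_type x) -> h \in 'C[x] -> (forall z, h z \in porbit x z) ->
  ~~ odd_perm h.
Proof.
move=> /allP odd_x /cent1_permP hx hO.
pose N := (\prod_(z : T) #|porbit x z|)%N.
have oddN : odd N.
  rewrite /N; elim/big_ind: _ => //= [m n om on|z _]; first by rewrite oddM om on.
  by apply: odd_x; apply: mem_cycle_type.
suff hN : h ^+ N = 1 by have := odd_permX h N; rewrite hN odd_perm1 oddN /= => <-.
apply/permP=> z; rewrite perm1; have [k hz] := porbitP _ _ _ (hO z).
have hm m : (h ^+ m) z = (x ^+ (k * m)) z.
  elim: m => [|m IHm]; first by rewrite muln0.
  by rewrite expgSr permM IHm (expg_permC hx) hz mulnS addnC expgD permM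
    -permM -expgD addnC expgD permM.
rewrite hm /N (bigD1 z) //= mulnCA expgM permX_fix // permX.
exact: iter_porbit.
Qed.

Lemma odd_cycle_type_Alt (T : finType) (x : {perm T}) :
  all odd (cycle_type x) -> x \in 'Alt_T.
Proof.
move=> odd_x; rewrite Alt_even; apply: even_cent1_porbits odd_x _ _ => [|z].
  exact: cent1id.
exact: (mem_porbit x 1).
Qed.

(** A cycle of even length is itself an odd element of the centralizer, and two
cycles of equal length can be merged into one; without these, every element of the
centralizer preserves all cycles. *)
Lemma cent1_sub_Alt (T : finType) (x : {perm T}) :
  ('C[x] \subset 'Alt_T) = uniq (cycle_type x) && all odd (cycle_type x).
Proof.
apply/subsetP/andP => [sCA | [/uniq_cycle_typeP uniq_x odd_x] h Ch]; last first.
  rewrite Alt_even; apply: even_cent1_porbits odd_x (Ch) _ => z.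
  by rewrite -eq_porbit_mem; apply/eqP; apply: uniq_x; apply: cent1_porbit_card.
split; last first.
  apply/allP=> _ /cycle_typeP[z ->]; have [d [dx dz _ _]] := cent1_restr_porbit x z.
  by have := sCA d dx; rewrite Alt_even dz negbK.
apply/uniq_cycle_typeP=> a b eq_ab; apply/eqP/negPn/negP=> ne_ab.
have [d [dx odd_d _ _ _]] := odd_cent1_merge ne_ab eq_ab.
by have := sCA d dx; rewrite Alt_even odd_d.
Qed.

(** * Recovering the cycle type from the centralizer in the alternating group *)

Definition altC (T : finType) (x : {perm T}) : {set {perm T}} := 'C_('Alt_T)[x].

Lemma altCP (T : finType) (x h : {perm T}) :
  reflect (~~ odd_perm h /\ h \in 'C[x]) (h \in altC x).
Proof. by rewrite in_setI Alt_even; apply: andP. Qed.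

(** What [C] sees of a point.  When [C] is the centralizer of an even permutation [x]
in the alternating group, the points of a cycle of [x] have the same orbit and the
same stabilizer under [C], because the powers of [x] lie in the centre of [C]; the
fibres of [orbit_stab C] thus recover
the cycles of [x] from [C] alone, up to possible merging of cycles. *)
Definition orbit_stab (T : finType) (C : {set {perm T}}) a :=
  ([set (h : {perm T}) a | h in C], [set h in C | h a == a]).

Definition blocks (T : finType) (C : {set {perm T}}) : {set {set T}} :=
  [set [set b | orbit_stab C b == orbit_stab C a] | a in T].

Lemma orbit_stab_porbit (T : finType) (x : {perm T}) a b :
  x \in 'Alt_T -> b \in porbit x a -> orbit_stab (altC x) a = orbit_stab (altC x) b.
Proof.
move=> Ax /porbitP[i ->]; have Cx : x ^+ i \in altC x.
  by rewrite groupX // inE Ax cent1id.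
congr (_, _).
  apply/setP=> z; apply/imsetP/imsetP=> -[h Ch ->].
    exists (x ^- i * h); first by rewrite groupM ?groupV.
    by rewrite permM permK.
  by exists (x ^+ i * h); rewrite ?groupM ?permM.
apply/setP=> h; rewrite [LHS]in_set [RHS]in_set.
case: (boolP (h \in altC x)) => //= /altCP[_ /cent1_permP hx].
by rewrite (expg_permC hx) (inj_eq perm_inj).
Qed.

Lemma orbit_stabP (T : finType) (x : {perm T}) a b :
    orbit_stab (altC x) a = orbit_stab (altC x) b ->
  (exists2 h, h \in altC x & h a = b)
    /\ forall h, h \in altC x -> h a = a -> h b = b.
Proof.
case=> orb stab; split.
  have : b \in [set (h : {perm T}) b | h in altC x].
    by apply/imsetP; exists 1; rewrite ?group1 ?perm1.
  by rewrite -orb => /imsetP[h Ch ->]; exists h.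
move=> h Ch ha; have : h \in [set h in altC x | h a == a] by rewrite inE Ch ha eqxx.
by rewrite stab inE => /andP[_ /eqP].
Qed.

Lemma card_porbit1 (T : finType) (x : {perm T}) a : (#|porbit x a| == 1%N) = (x a == a).
Proof.
have := expg_permE x 1 0 a; rewrite expg1 expg0 perm1 => ->.
by rewrite mod0n -/(_ %| 1) dvdn1.
Qed.

(** If two cycles of [x] are merged, the square of the second one, which is even
and fixes the first one pointwise, has to be trivial. *)
Lemma merge_card (T : finType) (x : {perm T}) a b :
    orbit_stab (altC x) a = orbit_stab (altC x) b -> b \notin porbit x a ->
  #|porbit x a| = #|porbit x b| /\ (#|porbit x b| == 1%N) || (#|porbit x b| == 2).
Proof.
move=> kab nab; have [[h /altCP[_ hx] ha] fixb] := orbit_stabP kab.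
split; first by rewrite -ha cent1_porbit_card.
have [d [dx _ dO dfix]] := cent1_restr_porbit x b.
(* The restriction [d] of [x] to the cycle of [b] may be odd; its square is even. *)
have dd : d * d \in altC x.
  by apply/altCP; split; [rewrite odd_permM addbb | rewrite groupM].
have da : d a = a by rewrite dfix // porbit_sym.
have := fixb _ dd; rewrite !permM !da => /(_ erefl) /eqP.
have xb : x b \in porbit x b by apply: (mem_porbit x 1).
rewrite (dO b (porbit_id x b)) (dO _ xb).
rewrite -!permM -[x * x]/(x ^+ 2) -[X in _ == X]perm1 -(expg0 x) expg_permE mod0n.
have /primeP[_ p2] := isT : prime 2; exact: p2.
Qed.

(** An odd [t] commuting with [x] that fixes [a] and moves [b] can correct the sign
of any odd element commuting with [x] and fixing [a] and [b]; as the result would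
be an even element fixing [a] and moving [b], there is no such odd element.  Hence
the remaining cycles are odd and of distinct lengths. *)
Lemma merge_rest (T : finType) (x t : {perm T}) a b :
    orbit_stab (altC x) a = orbit_stab (altC x) b ->
    t \in 'C[x] -> odd_perm t -> t a = a -> t b != b ->
  (forall c, c \notin porbit x a -> c \notin porbit x b -> odd #|porbit x c|)
  /\ (forall c d, c \notin porbit x a -> c \notin porbit x b ->
        d \notin porbit x a -> d \notin porbit x b ->
        #|porbit x c| = #|porbit x d| -> porbit x c = porbit x d).
Proof.
move=> kab tx odd_t ta tb; have [_ fixb] := orbit_stabP kab.
have even_fix d : d \in 'C[x] -> d a = a -> d b = b -> ~~ odd_perm d.
  move=> dx da db; apply: contra tb => odd_d; apply/eqP/(perm_inj (s := d)).
  rewrite db -permM; apply: fixb; last by rewrite permM ta.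
  by apply/altCP; rewrite odd_permM odd_t odd_d groupM.
split=> [c nac nbc | c d nac nbc nad nbd eq_cd].
  have [d [dx odd_d _ dfix]] := cent1_restr_porbit x c.
  rewrite -[odd _]negbK -odd_d; apply: even_fix; rewrite // dfix // porbit_sym //.
apply/eqP/negPn/negP=> ne_cd; have [e [ex odd_e _ _ efix]] := odd_cent1_merge ne_cd eq_cd.
by have := even_fix e ex; rewrite odd_e !efix //; try (by rewrite porbit_sym);
  move=> /(_ erefl erefl).
Qed.

Lemma exceptional_perm (s t : seq nat) : perm_eq s t -> exceptional s = exceptional t.
Proof.
move=> st; rewrite /exceptional (perm_all _ st) (seq.permP st).
by rewrite (perm_uniq (perm_filter _ st)).
Qed.

Lemma perm_eq_uniq_card (T : finType) (P Q : seq {set T}) :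
  uniq P -> uniq Q -> P =i Q ->
  perm_eq [seq #|A| | A : {set T} <- P] [seq #|A| | A : {set T} <- Q].
Proof. by move=> uP uQ PQ; apply/perm_map/uniq_perm. Qed.

Definition block_sizes (T : finType) (C : {set {perm T}}) : seq nat :=
  [seq #|A| | A : {set T} <- enum (blocks C)].

(** With a third fixed point [c] the transposition of [b] and [c] is an odd
correcting element. *)
Lemma merge_exceptional (T : finType) (x : {perm T}) a b c :
    orbit_stab (altC x) a = orbit_stab (altC x) b -> a != b -> c != a -> c != b ->
    x a = a -> x b = b -> x c = c ->
  exceptional (cycle_type x).
Proof.
move=> kab nab nca ncb xa xb xc.
have fixO u : x u = u -> porbit x u = [set u].
  move=> xu; have /eqP/cards1P[v uv] : #|porbit x u| = 1%N.
    by apply/eqP; rewrite card_porbit1 xu.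
  by rewrite uv; congr [set _]; apply/esym/set1P; rewrite -uv porbit_id.
have [||||odd_rest uniq_rest] := @merge_rest T x (tperm b c) a b kab.
- apply/cent1_permP=> z; rewrite (inj_tperm b c z (@perm_inj _ x)).
  by rewrite xb xc.
- by rewrite odd_tperm eq_sym.
- by rewrite tpermD // eq_sym.
- by rewrite tpermL.
rewrite fixO // fixO // in odd_rest uniq_rest.
set D := porbits x :\ [set a] :\ [set b] :\ [set c].
pose P := [set a] :: [set b] :: [set c] :: enum D.
have xP : perm_eq (cycle_type x) [seq #|A| | A : {set T} <- P].
  apply: cycle_type_perm => [|A].
    by rewrite /= !inE !mem_enum !inE !eqxx !andbF !(inj_eq set1_inj) enum_uniq
      (negPf nab) ![_ == c]eq_sym (negPf nca) (negPf ncb).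
  have fixA u : x u = u -> [set u] \in porbits x by move/fixO<-; apply: mem_porbits.
  rewrite !inE mem_enum !inE.
  case: (eqVneq A [set a]) => [->|_]; first by rewrite fixA.
  case: (eqVneq A [set b]) => [->|_]; first by rewrite fixA.
  by case: (eqVneq A [set c]) => [->|_]; first by rewrite fixA.
have DP A : A \in D ->
    exists z, [/\ A = porbit x z, z \notin [set a], z \notin [set b] & z != c].
  rewrite !inE => /and4P[nc nb na /imsetP[z _ AE]]; exists z; rewrite !inE.
  split=> //; [move: na | move: nb | move: nc];
  by apply: contraNneq => zE; rewrite AE zE fixO.
rewrite (exceptional_perm xP) /exceptional /= !cards1 /=.
have odd_card A : A \in D -> odd #|A| && (#|A| != 1%N).
  case/DP=> z [-> na nb nc]; rewrite odd_rest //= card_porbit1.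
  apply/eqP=> xz.
  have := uniq_rest z c; rewrite !inE in na nb *; rewrite na nb nca ncb.
  rewrite !fixO // !cards1 => /(_ isT isT isT isT erefl) /set1_inj/eqP.
  by rewrite (negPf nc).
apply/and3P; split.
- apply/allP=> _ /mapP[A + ->]; rewrite mem_enum => /odd_card/andP[].
  by [].
- rewrite eqSS eqSS eqSS; apply/eqP/count_memPn/mapP=> -[A]; rewrite mem_enum.
  by move/odd_card/andP=> [_ /eqP n1] /esym.
rewrite (all_filterP _); last first.
  by apply/allP=> _ /mapP[A + ->]; rewrite mem_enum => /odd_card/andP[].
rewrite map_inj_in_uniq ?enum_uniq // => A B; rewrite !mem_enum.
by move=> /DP[z [-> na nb _]] /DP[u [-> ua ub _]]; apply: uniq_rest.
Qed.

(** Outside the exceptional types at most one pair of cycles is merged: two fixed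
points, when there are no others, or two cycles of length [2], when all other
cycles are odd.  For cycles of length [2] the correcting element of [merge_rest] is
one of these two transpositions. *)
Lemma merge_unique (T : finType) (x : {perm T}) a b :
    ~~ exceptional (cycle_type x) ->
    orbit_stab (altC x) a = orbit_stab (altC x) b -> b \notin porbit x a ->
  (forall c d, orbit_stab (altC x) c = orbit_stab (altC x) d -> d \notin porbit x c ->
     (c \in porbit x a :|: porbit x b) && (d \in porbit x a :|: porbit x b))
  /\ (#|porbit x b| = 1%N \/
     #|porbit x b| = 2 /\ forall c, c \notin porbit x a -> c \notin porbit x b ->
        odd #|porbit x c|).
Proof.
move=> nspec kab nab; have [cab /orP b12] := merge_card kab nab.
have two u v : orbit_stab (altC x) u = orbit_stab (altC x) v -> v \notin porbit x u ->
    #|porbit x v| = 2 -> 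
  (forall c, c \notin porbit x u -> c \notin porbit x v -> odd #|porbit x c|)
  /\ (forall c d, c \notin porbit x u -> c \notin porbit x v ->
        d \notin porbit x u -> d \notin porbit x v ->
        #|porbit x c| = #|porbit x d| -> porbit x c = porbit x d).
  move=> kuv nuv v2; have [t [tx odd_t tO tfix]] := cent1_restr_porbit x v.
  apply: (merge_rest kuv tx); first by rewrite odd_t v2.
    by rewrite tfix // porbit_sym.
  by rewrite tO ?porbit_id // -card_porbit1 v2.
have sym c d : d \notin porbit x c -> c \notin porbit x d by rewrite porbit_sym.
have b12' : #|porbit x b| = 1%N \/ #|porbit x b| = 2.
  by case: b12 => /eqP; [left | right].
split; last first.
  case: b12' => b2; [by left | right; split=> //].
  by have [] := two a b kab nab b2.
move=> c d kcd ncd; have [ccd /orP d12] := merge_card kcd ncd.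
rewrite !in_setU.
case: b12' => b2.
  have fix_b : x b = b by apply/eqP; rewrite -card_porbit1 b2.
  have fix_a : x a = a by apply/eqP; rewrite -card_porbit1 cab b2.
  have ne_ab : a != b by apply: contraNneq nab => ->; apply: porbit_id.
  case: d12 => /eqP d2.
    have fix_d : x d = d by apply/eqP; rewrite -card_porbit1 d2.
    have fix_c : x c = c by apply/eqP; rewrite -card_porbit1 ccd d2.
    have ab u : x u = u -> (u \in porbit x a) || (u \in porbit x b).
      move=> xu; case: (eqVneq u a) => [->|nua]; first by rewrite porbit_id.
      case: (eqVneq u b) => [->|nub]; first by rewrite porbit_id orbT.
      by case/negP: nspec; apply: (@merge_exceptional _ _ a b u).
    by rewrite !ab.
  have [_ uniq_rest] := two c d kcd ncd d2.
  have nin u v : x u = u -> #|porbit x v| = 2 -> u \notin porbit x v.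
    move=> xu v2; apply/negP=> /porbit_eq uv.
    by have /eqP := card_porbit1 x u; rewrite uv v2 xu eqxx.
  have := uniq_rest a b; rewrite !nin ?ccd ?cab // => /(_ isT isT isT isT erefl) abE.
  by case/negP: nab; rewrite abE porbit_id.
have [odd_rest uniq_rest] := two a b kab nab b2.
have in_ab u : ~~ odd #|porbit x u| -> (u \in porbit x a) || (u \in porbit x b).
  by apply: contraR; rewrite negb_or => /andP[]; apply: odd_rest.
case: d12 => /eqP d2; last by rewrite !in_ab ?ccd ?d2.
have no u v : #|porbit x u| = 1%N -> #|porbit x v| = 2 -> u \notin porbit x v.
  by move=> u1 v2; apply/negP=> /porbit_eq uv; move: u1; rewrite uv v2.
have := uniq_rest c d; rewrite !no ?ccd ?cab // => /(_ isT isT isT isT erefl) cdE.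
by case/negP: ncd; rewrite cdE porbit_id.
Qed.

(** The sizes of the fibres of [orbit_stab] are thus either the cycle type, or the
cycle type with two parts [k] replaced by one part [2 * k]. *)
Lemma block_sizes_cases (T : finType) (x : {perm T}) :
    x \in 'Alt_T -> ~~ exceptional (cycle_type x) ->
  perm_eq (cycle_type x) (block_sizes (altC x))
  \/ exists k r, [/\ perm_eq (cycle_type x) (k :: k :: r),
       perm_eq (block_sizes (altC x)) (k + k :: r)%N
       & k = 1%N \/ k = 2 /\ all odd r].
Proof.
move=> Ax nexc; set C := altC x.
have kO a b : b \in porbit x a -> orbit_stab C b = orbit_stab C a.
  by move=> ab; rewrite (orbit_stab_porbit Ax ab).
pose block z := [set u | orbit_stab C u == orbit_stab C z].
case: (boolP [forall a, forall b,
                (orbit_stab C a == orbit_stab C b) ==> (b \in porbit x a)]).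
  move=> /forallP noM; left; rewrite /block_sizes.
  suff -> : blocks C = porbits x by apply/perm_map/perm_sorted_porbits.
  apply: eq_imset => a; apply/setP=> b; rewrite inE.
  apply/idP/idP => [kab | /kO->//]; have /forallP/(_ b)/implyP := noM a.
  by apply; rewrite eq_sym.
rewrite negb_forall => /existsP[a]; rewrite negb_forall => /existsP[b].
rewrite negb_imply => /andP[/eqP kab nab]; right.
have [cab _] := merge_card kab nab.
have [uniq_ab k12] := merge_unique nexc kab nab.
set A := porbit x a in nab cab uniq_ab k12 *; set B := porbit x b in cab uniq_ab k12 *.
have nAB : A != B by apply: contraNneq nab => ->; apply: porbit_id.
pose D := porbits x :\ A :\ B.
have DP X : X \in D -> exists z, [/\ X = porbit x z, z \notin A & z \notin B].
  rewrite !inE => /and3P[nB nA /imsetP[z _ XE]]; exists z; split=> //.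
    by apply: contra nA => /porbit_eq zA; rewrite XE zA.
  by apply: contra nB => /porbit_eq zB; rewrite XE zB.
exists #|B|, [seq #|X| | X : {set T} <- enum D]; split.
- rewrite -{1}cab.
  apply: (cycle_type_perm (P := A :: B :: enum D)) => [|X].
    by rewrite /= !inE !mem_enum !inE !eqxx andbF (negPf nAB) enum_uniq.
  rewrite !inE mem_enum !inE.
  case: (eqVneq X A) => [->|_]; first by rewrite mem_porbits.
  by case: (eqVneq X B) => [->|_] //; rewrite mem_porbits.
- have disj : #|A :|: B| = (#|B| + #|B|)%N.
    rewrite cardsU (_ : A :&: B = set0) ?cards0 ?subn0 ?cab //.
    apply/eqP/set0Pn=> -[z /setIP[Az Bz]]; case/negP: nAB.
    by rewrite /A /B -(porbit_eq Az) -(porbit_eq Bz).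
  rewrite -disj; apply: (perm_eq_uniq_card (Q := (A :|: B) :: enum D)).
  + exact: enum_uniq.
  + rewrite /= enum_uniq andbT mem_enum; apply/negP=> /DP[z [ABz nAz _]].
    have : a \in porbit x z by rewrite -ABz inE porbit_id.
    by rewrite porbit_sym (negPf nAz).
  have block_in z : z \in A :|: B -> block z = A :|: B.
    move=> ABz; apply/setP=> u; rewrite inE.
    have kE v : v \in A :|: B -> orbit_stab C v = orbit_stab C a.
      by rewrite in_setU => /orP[/kO //|/kO ->].
    apply/eqP/idP => [kuz | ABu]; last by rewrite !kE.
    case: (boolP (u \in porbit x z)) => [/porbit_eq uz | nuz].
      move: ABz; rewrite !in_setU -!eq_porbit_mem uz; exact.
    by have /andP[] := uniq_ab z u (esym kuz) nuz.
  have block_out z : z \notin A :|: B -> block z = porbit x z.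
    move=> nABz; apply/setP=> u; rewrite inE; apply/eqP/idP=> [kuz | /kO//].
    apply: contraR nABz => nuz; by have /andP[] := uniq_ab z u (esym kuz) nuz.
  move=> X; rewrite mem_enum inE mem_enum; apply/imsetP/predU1P.
    case=> z _ ->; rewrite -/(block z).
    case: (boolP (z \in A :|: B)) => [/block_in|nABz]; first by left.
    right; rewrite block_out // !inE mem_porbits !eq_porbit_mem andbT.
    by rewrite in_setU negb_or andbC in nABz.
  case=> [-> | /DP[z [-> nAz nBz]]].
    by exists a; rewrite // -/(block a) block_in // inE porbit_id.
  by exists z; rewrite // -/(block z) block_out // in_setU negb_or nAz.
case: k12 => [|[-> odd_r]]; [by left | right; split=> //].
apply/allP=> _ /mapP[X + ->]; rewrite mem_enum => /DP[z [-> nAz nBz]].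
exact: odd_r.
Qed.

(** The sizes of the fibres depend on the centralizer only.  A merge lowers the
number of parts by one, and all even permutations have the same parity of the
number of cycles; hence a merge occurs for both of [x] and [y] or for neither.  A
merge of fixed points for one and of transpositions for the other is excluded,
since the former produces a fibre of size [2], and the latter only fibres of size
[4] or odd size. *)
Lemma cycle_type_altC (T : finType) (x y : {perm T}) :
    x \in 'Alt_T -> y \in 'Alt_T ->
    ~~ exceptional (cycle_type x) -> ~~ exceptional (cycle_type y) ->
  altC x = altC y -> cycle_type x = cycle_type y.
Proof.
move=> Ax Ay ex ey Cxy.
have par : odd (size (cycle_type x)) = odd (size (cycle_type y)).
  move: Ax Ay; rewrite !Alt_even !odd_perm_cycle_type.
  by case: (odd #|T|); do 2![case: (odd (size _))].
apply: sorted_geq_eq; rewrite ?sorted_cycle_type //.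
have := block_sizes_cases Ax ex; have := block_sizes_cases Ay ey.
rewrite -Cxy; set s := block_sizes _.
case=> [ys | [k [r [yr sr kr]]]] [xs | [k' [r' [xr sr' kr']]]].
- by rewrite (perm_trans xs) // perm_sym.
- move: par; rewrite (perm_size ys) (perm_size xr) (perm_size sr') /=.
  by case: (odd _).
- move: par; rewrite (perm_size xs) (perm_size yr) (perm_size sr) /=.
  by case: (odd _).
have rr : perm_eq (k + k :: r)%N (k' + k' :: r')%N.
  by rewrite perm_sym in sr; apply: perm_trans sr sr'.
rewrite (permPl xr) perm_sym (permPl yr).
case: kr kr' rr => [->|[-> odd_r]] [->|[-> odd_r']]; rewrite ?perm_cons //.
  move/perm_mem/(_ 2); rewrite !inE /= => /esym/(allP odd_r').
  by [].
by move/perm_mem/(_ 2); rewrite !inE /= => /(allP odd_r).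
Qed.

(** * The exceptional coincidence *)

Lemma cent1_mem_porbit (T : finType) (x h : {perm T}) u v :
  h \in 'C[x] -> (h u \in porbit x (h v)) = (u \in porbit x v).
Proof.
move/cent1_permP=> hx; rewrite (porbit_intertwine hx) mem_imset //.
exact: perm_inj.
Qed.

(** If [h] moved the cycle of [a], it would exchange it with the only other cycle of
the same length.  Merging these two cycles into an odd element [d], the product of
[h] and [d] preserves every cycle, so it is even, and [h] is odd. *)
Lemma altC_fixes_porbit (T : finType) (y h : {perm T}) a :
    all odd (cycle_type y) ->
    (forall u v, u \notin porbit y a -> v \notin porbit y a ->
       #|porbit y u| = #|porbit y v| -> porbit y u = porbit y v) ->
  h \in altC y -> h a \in porbit y a.
Proof.
move=> odd_y uniq_y /altCP[even_h hy]; apply: contraR even_h => nha.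
have ne : porbit y a != porbit y (h a) by rewrite eq_sym eq_porbit_mem.
have [d [dy odd_d da dha dfix]] := odd_cent1_merge ne (esym (cent1_porbit_card a hy)).
suff : ~~ odd_perm (h * d) by rewrite odd_permM odd_d addbT negbK.
apply: even_cent1_porbits odd_y _ _ => [|z]; first by rewrite groupM.
have /cent1_permP hyE := hy; have /cent1_permP dyE := dy.
have cardh u : #|porbit y (h u)| = #|porbit y u| by apply: cent1_porbit_card.
rewrite permM; case: (boolP (z \in porbit y a)) => [/porbitP[i ->] | nza].
  rewrite (expg_permC hyE) (expg_permC dyE) dha -permM -expgS.
  by rewrite -eq_porbit_mem !porbit_perm.
case: (boolP (z \in porbit y (h a))) => [/porbitP[i ->] | nzha].
  have : h (h a) \in porbit y a.
    apply/negPn/negP=> nhha.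
    have := uniq_y _ _ nhha nha (cardh _) => /eqP.
    by rewrite eq_porbit_mem cent1_mem_porbit // (negPf nha).
  case/porbitP=> j hha; rewrite (expg_permC hyE) hha !(expg_permC dyE) da.
  by rewrite -eq_porbit_mem !porbit_perm.
have nhza : h z \notin porbit y a.
  apply/negP=> /porbit_eq hza.
  case/negP: nzha; rewrite -eq_porbit_mem; apply/eqP; apply: uniq_y => //.
  by rewrite cardh -(cardh z) hza.
have hz : h z \in porbit y z.
  by rewrite -eq_porbit_mem; apply/eqP; apply: uniq_y.
rewrite dfix //; apply: contra nzha => /porbit_eq hza.
by rewrite -eq_porbit_mem -hza (porbit_eq hz).
Qed.

Lemma uniq_map_inj_in (T1 T2 : eqType) (f : T1 -> T2) (s : seq T1) :
  uniq (map f s) -> {in s &, injective f}.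
Proof.
elim: s => // a s IHs /= /andP[nfa /IHs inj_s] u v; rewrite !inE.
case/predU1P=> [->|su] /predU1P[->|sv] // e.
- by case/negP: nfa; rewrite e map_f.
- by case/negP: nfa; rewrite -e map_f.
exact: inj_s.
Qed.

Lemma exceptionalP (T : finType) (x : {perm T}) :
    exceptional (cycle_type x) ->
  [/\ all odd (cycle_type x),
      exists a b c, [/\ a != b, a != c, b != c
        & forall z, (x z == z) = [|| z == a, z == b | z == c]]
    & forall u v, x u != u -> x v != v ->
        #|porbit x u| = #|porbit x v| -> porbit x u = porbit x v].
Proof.
case/and3P=> odd_x /eqP one_x uniq_x; split=> //; last first.
  move=> u v xu xv cuv.
  have uS : porbit x u \in [seq A : {set T} <- sorted_porbits x | #|A| != 1%N].
    by rewrite mem_filter card_porbit1 xu mem_sorted_porbits mem_porbits.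
  have vS : porbit x v \in [seq A : {set T} <- sorted_porbits x | #|A| != 1%N].
    by rewrite mem_filter card_porbit1 xv mem_sorted_porbits mem_porbits.
  rewrite /cycle_type filter_map in uniq_x; exact: (uniq_map_inj_in uniq_x uS vS cuv).
have S3 : #|[set z | x z == z]| = 3.
  rewrite -one_x /cycle_type count_map -(card_imset _ set1_inj).
  rewrite (seq.permP (perm_sorted_porbits x)) -size_filter.
  rewrite cardE; apply/perm_size/uniq_perm; first exact: enum_uniq.
    exact/filter_uniq/enum_uniq.
  move=> A; rewrite mem_enum mem_filter mem_enum /=.
  apply/imsetP/andP => [[z + ->] | [/cards1P[w Aw] /imsetP[z _ AE]]].
    rewrite inE -card_porbit1 => /cards1P[w zw].
    have /set1P zE : z \in [set w] by rewrite -zw porbit_id.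
    by rewrite cards1 zE -zw mem_porbits.
  exists w; rewrite // inE -card_porbit1.
  have /porbit_eq -> : w \in porbit x z by rewrite -AE Aw inE.
  by rewrite -AE Aw cards1.
have /card_gt0P[a aS] : 0 < #|[set z | x z == z]| by rewrite S3.
have /cards2P[b [c [bc SE]]] : #|[set z | x z == z] :\ a| == 2.
  by move: S3; rewrite (cardsD1 a) aS => -[e]; apply/eqP; exact: e.
have SP z : (x z == z) = [|| z == a, z == b | z == c].
  have := in_setD1 z [set z | x z == z] a; rewrite SE !inE => ->.
  case: (eqVneq z a) => [->|_] //=; by move: aS; rewrite inE.
have nab u : u \in [set b; c] -> a != u by rewrite -SE !inE eq_sym => /andP[].
by exists a, b, c; rewrite bc !nab ?inE ?eqxx ?orbT.
Qed.

(** The permutation [y] is obtained from [x] by joining its three fixed points into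
one 3-cycle [t], so that its type is [3 + mu].  An even element commuting with [x]
permutes the fixed points evenly, hence commutes with [t].  Conversely an even
element commuting with [y] preserves the cycle [t] by [altC_fixes_porbit], even if
[mu] has a part [3], hence commutes with [x]. *)
Lemma exceptional_altC (T : finType) (x : {perm T}) :
    exceptional (cycle_type x) ->
  exists y : {perm T}, [/\ y \in 'Alt_T, ~~ exceptional (cycle_type y)
    & altC y = altC x].
Proof.
case/exceptionalP=> odd_x [a [b [c [nab nac nbc xS]]]] uniq_x.
have xa : x a = a by apply/eqP; rewrite xS eqxx.
have xb : x b = b by apply/eqP; rewrite xS eqxx orbT.
have xc : x c = c by apply/eqP; rewrite xS eqxx !orbT.
pose t := tperm a b * tperm a c; pose y := x * t.
have ta : t a = b by rewrite permM tpermL tpermD // eq_sym.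
have tb : t b = c by rewrite permM tpermR tpermL.
have tc : t c = a by rewrite permM (tpermD nac nbc) tpermR.
have tfix z : x z != z -> t z = z.
  by rewrite xS !negb_or => /and3P[za zb zc]; rewrite permM !tpermD // eq_sym.
have yfix z : x z = z -> y z = t z by rewrite permM => ->.
have yx z : x z != z -> y z = x z.
  by move=> xz; rewrite permM tfix ?(inj_eq perm_inj).
have [ya yb yc] : [/\ y a = b, y b = c & y c = a] by rewrite !yfix.
have SE z : x z = z -> [\/ z = a, z = b | z = c].
  by move/eqP; rewrite xS => /or3P[] /eqP->;
    [constructor 1 | constructor 2 | constructor 3].
have yO z : x z != z -> porbit y z = porbit x z.
  move=> xz; have e i : (y ^+ i) z = (x ^+ i) z /\ x ((x ^+ i) z) != (x ^+ i) z.
    elim: i => [|i [IHi nfix]]; first by rewrite perm1.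
    by rewrite !expgSr (permM _ y) (permM _ x) IHi yx // (inj_eq perm_inj).
  by apply/setP=> u; apply/porbitP/porbitP=> -[i ->]; exists i; rewrite (proj1 (e i)).
have Sy z : (z \in porbit y a) = (x z == z).
  rewrite xS; apply/porbitP/idP=> [[i ->] | /or3P[] /eqP->].
  - elim: i => [|i]; first by rewrite perm1 eqxx.
    by rewrite expgSr permM => /or3P[] /eqP->; rewrite ?ya ?yb ?yc eqxx ?orbT.
  - by exists 0; rewrite perm1.
  - by exists 1%N; rewrite expg1 ya.
  by exists 2; rewrite expgS expg1 permM ya yb.
have cardS : #|porbit y a| = 3.
  have -> : porbit y a = a |: [set b; c].
    by apply/setP=> z; rewrite Sy xS !inE.
  by rewrite cardsU1 cards2 !inE negb_or nab nac nbc.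
have yO_S z : x z = z -> porbit y z = porbit y a.
  by move/eqP; rewrite -Sy; apply: porbit_eq.
have odd_y : all odd (cycle_type y).
  apply/allP=> _ /cycle_typeP[z ->]; case: (eqVneq (x z) z) => [xz | xz].
    by rewrite yO_S // cardS.
  by rewrite yO // (allP odd_x) ?mem_cycle_type.
have uniq_y u v : u \notin porbit y a -> v \notin porbit y a ->
    #|porbit y u| = #|porbit y v| -> porbit y u = porbit y v.
  by rewrite !Sy => xu xv; rewrite !yO //; apply: uniq_x.
exists y; split.
- exact: odd_cycle_type_Alt.
- apply/and3P=> -[_ + _]; rewrite (count_memPn _) //.
  apply/cycle_typeP=> -[z /esym/eqP]; rewrite card_porbit1.
  case: (eqVneq (x z) z) => [xz | xz]; last by rewrite yx // (negPf xz).
  by rewrite yfix //; case: (SE z xz) => ->;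
    rewrite ?ta ?tb ?tc ?[_ == c]eq_sym 1?eq_sym ?(negPf nab)
    ?(negPf nac) ?(negPf nbc) // eq_sym (negPf nac).
have even_fix d : d \in 'C[x] -> d a = a -> d b = b -> d c = c -> ~~ odd_perm d.
  move=> dx da db dc; apply: even_cent1_porbits odd_x (dx) _ => z.
  case: (eqVneq (x z) z) => [/SE[]-> | xz]; rewrite ?da ?db ?dc ?porbit_id //.
  rewrite -eq_porbit_mem; apply/eqP/uniq_x => //; last exact: cent1_porbit_card.
  by move/cent1_permP: dx => <-; rewrite (inj_eq perm_inj).
apply/setP=> h; apply/idP/idP => Ch; have /altCP[even_h hC] := Ch.
  apply/altCP; split=> //; apply/cent1_permP=> z.
  have ha := altC_fixes_porbit odd_y uniq_y Ch.
  have hS u : (x (h u) == h u) = (x u == u).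
    by rewrite -!Sy -[in LHS](porbit_eq ha) cent1_mem_porbit.
  case: (eqVneq (x z) z) => [xz | xz].
    by rewrite xz; apply/esym/eqP; rewrite hS xz.
  by rewrite -yx // -yx ?hS //; move/cent1_permP: hC.
apply/altCP; split=> //.
have hx := cent1_permP _ _ hC.
suff ht : h \in 'C[t].
  by apply/cent1P/commuteM; apply/cent1P.
have hS z : (x (h z) == h z) = (x z == z) by rewrite -hx (inj_eq perm_inj).
have tO z : x z != z -> t z = z := @tfix z.
have [ra rb rc] : [/\ x (h a) = h a, x (h b) = h b & x (h c) = h c].
  by split; apply/eqP; rewrite hS ?xa ?xb ?xc.
have hab : h a != h b by rewrite (inj_eq perm_inj).
have hac : h a != h c by rewrite (inj_eq perm_inj).
have hbc : h b != h c by rewrite (inj_eq perm_inj).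
(* If [h] followed by a transposition of two fixed points fixes all three of them,
   then [even_fix] makes [h] odd. *)
have odd_case u v : u != v -> x u = u -> x v = v ->
    tperm u v (h a) = a -> tperm u v (h b) = b -> tperm u v (h c) = c -> False.
  move=> nuv xu xv ea eb ec; have := @even_fix (h * tperm u v).
  rewrite !permM odd_permM odd_tperm nuv addbT even_h => H; apply/negP/H => //.
  rewrite groupM //; apply/cent1_permP=> z.
  by rewrite (inj_tperm u v z (@perm_inj _ x)) xu xv.
apply/cent1_permP=> z; case: (eqVneq (x z) z) => [|xz]; last by rewrite !tfix ?hS.
have nba : b != a by rewrite eq_sym.
have nca : c != a by rewrite eq_sym.
have ncb : c != b by rewrite eq_sym.
have Tab := odd_case a b nab xa xb.
have Tac := odd_case a c nac xa xc.
have Tbc := odd_case b c nbc xb xc.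
case: (SE _ ra) => ea; case: (SE _ rb) => eb; case: (SE _ rc) => ec;
  try (by rewrite ea eb eqxx in hab); try (by rewrite ea ec eqxx in hac);
  try (by rewrite eb ec eqxx in hbc);
  try (by case/SE=> ->; rewrite ?ta ?tb ?tc ?ea ?eb ?ec ?ta ?tb ?tc).
- by case: Tbc; rewrite ?ea ?eb ?ec ?tpermL ?tpermR // tpermD.
- by case: Tab; rewrite ?ea ?eb ?ec ?tpermL ?tpermR // tpermD.
by case: Tac; rewrite ?ea ?eb ?ec ?tpermL ?tpermR // tpermD.
Qed.

(** * Signs of permutations of fibred sets *)

Lemma extend_perm (S T : finType) (phi : S -> T) (s : {perm S}) :
    injective phi ->
  exists w : {perm T}, [/\ forall i, w (phi i) = phi (s i),
    forall z, z \notin codom phi -> w z = z & w = s :> bool].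
Proof.
move=> phi_inj; have [ts -> _] := prod_tpermP s.
elim: ts => [|[a b] ts [w [w_phi w_out odd_w]]] /=.
  by exists 1; rewrite big_nil !odd_perm1; split=> // [i|z _]; rewrite !perm1.
exists (tperm (phi a) (phi b) * w); rewrite big_cons.
split=> [i | z nz |]; last by rewrite !odd_mul_tperm odd_w (inj_eq phi_inj).
  by rewrite !permM -w_phi (inj_tperm _ _ _ phi_inj).
by rewrite permM tpermD ?w_out //; apply: contraNneq nz => <-; apply: codom_f.
Qed.

Lemma odd_perm_extend (S T : finType) (phi : S -> T) (s : {perm S}) (w : {perm T}) :
    injective phi -> (forall i, w (phi i) = phi (s i)) ->
    (forall z, z \notin codom phi -> w z = z) ->
  w = s :> bool.
Proof.
move=> phi_inj w_phi w_out; have [w' [w'_phi w'_out <-]] := extend_perm s phi_inj.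
congr odd_perm; apply/permP=> z.
have [/codomP[i ->] | nz] := boolP (z \in codom phi); first by rewrite w_phi w'_phi.
by rewrite w_out ?w'_out.
Qed.

Lemma fiber_norm (T : finType) (I : eqType) (f : T -> I) (w : {perm T}) i :
  (forall z, f (w z) = f z) -> w \in 'N([set z | f z == i] | 'P).
Proof. by move=> fw; apply/astabsP=> z; rewrite !inE /= /aperm fw. Qed.

(** A permutation preserving each fibre of [f] is the product of its restrictions
to the fibres. *)
Lemma odd_perm_fibers (T I : finType) (f : T -> I) (w : {perm T}) :
    (forall z, f (w z) = f z) ->
  w = \big[addb/false]_i restr_perm [set z | f z == i] w :> bool.
Proof.
move=> fw; pose R i := restr_perm [set z | f z == i] w.
have RE i z : R i z = if f z == i then w z else z.
  rewrite /R; case: ifPn => fz; first by rewrite restr_permE ?fiber_norm ?inE.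
  by rewrite (out_perm (restr_perm_on _ _)) ?inE.
suff wE : w = \prod_i R i.
  rewrite [in LHS]wE; exact: (big_morph _ (@odd_permM T) (@odd_perm1 T)).
have prodE r z : uniq r -> (\prod_(i <- r) R i) z = if f z \in r then w z else z.
  elim: r z => [|i r IHr] z /=; first by rewrite big_nil perm1.
  case/andP=> nir ur; rewrite big_cons permM RE inE IHr //.
  by case: (eqVneq (f z) i) => [fz|] //=; rewrite fw fz (negPf nir).
apply/permP=> z; rewrite prodE ?index_enum_uniq //.
by rewrite mem_index_enum.
Qed.

(** The case of fibres all identified with [B], on which [w] acts by permutations of
the same sign. *)
Lemma odd_perm_fibration (T I B : finType) (f : T -> I) (phi : I -> B -> T)
    (F : I -> {perm B}) (w : {perm T}) (e : bool) :
    (forall i, injective (phi i)) -> (forall i b, f (phi i b) = i) ->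
    (forall z, exists b, z = phi (f z) b) ->
    (forall i b, w (phi i b) = phi i (F i b)) -> (forall i, F i = e :> bool) ->
  w = odd #|I| && e :> bool.
Proof.
move=> phi_inj f_phi phi_onto w_phi odd_F.
have fw z : f (w z) = f z by have [b ->] := phi_onto z; rewrite w_phi !f_phi.
rewrite (odd_perm_fibers fw) (eq_bigr (fun=> e)) => [|i _].
  by rewrite big_const; elim: #|I| => //= n ->; case: (odd n); rewrite /= ?addbb ?addbF.
rewrite -(odd_F i); apply: (odd_perm_extend (phi_inj i)) => [b | z nz].
  by rewrite restr_permE ?fiber_norm ?inE ?f_phi.
apply: (out_perm (restr_perm_on _ _)); rewrite inE; apply: contraNneq nz => <-.
by have [b ->] := phi_onto z; rewrite f_phi codom_f.
Qed.

(** * The sign of multiplication by a unit modulo an odd number *)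

Lemma exists_scale_perm l u : coprime u l ->
  exists s : {perm 'I_l}, forall i, s i = u * i %% l :> nat.
Proof.
move=> co_ul; have l0 (i : 'I_l) : 0 < l by apply: leq_ltn_trans (ltn_ord i).
pose f (i : 'I_l) : 'I_l := Ordinal (ltn_pmod (u * i) (l0 i)).
suff f_inj : injective f by exists (perm f_inj) => i; rewrite permE.
move=> i j /(congr1 val) /= /eqP e; apply/val_inj/eqP; rewrite /=.
wlog le_ij : i j e / i <= j.
  by case: (leqP i j) => [le|/ltnW le] H; [|rewrite eq_sym]; apply: H; rewrite // eq_sym.
move: e; rewrite eq_sym eqn_mod_dvd ?leq_mul // -mulnBr Gauss_dvdr 1?coprime_sym //.
move=> dv; rewrite eqn_leq le_ij -subn_eq0; move: dv; apply: contraLR; rewrite -lt0n.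
move=> lt0; rewrite gtnNdvd //; apply: leq_ltn_trans (leq_subr _ _) (ltn_ord j).
Qed.

(** Translations of [Z/l] with [l] odd have odd order. *)
Lemma exists_shift_perm l v : odd l ->
  exists2 s : {perm 'I_l}, forall i, s i = (i + v) %% l :> nat & ~~ odd_perm s.
Proof.
move=> odd_l; have l0 (i : 'I_l) : 0 < l by apply: leq_ltn_trans (ltn_ord i).
pose f (i : 'I_l) : 'I_l := Ordinal (ltn_pmod (i + v) (l0 i)).
have f_inj : injective f.
  move=> i j /(congr1 val) /= /eqP; rewrite eqn_modDr !modn_small // => /eqP.
  exact: val_inj.
exists (perm f_inj) => [i|]; first by rewrite permE.
have : perm f_inj ^+ l = 1.
  apply/permP=> i; rewrite perm1; apply: val_inj.
  have sm m : (perm f_inj ^+ m) i = (i + m * v) %% l :> nat.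
    elim: m => [|m IHm]; first by rewrite perm1 addn0 modn_small.
    by rewrite expgSr permM permE /= IHm modnDml -addnA mulSnr.
  by rewrite /= sm addnC mulnC modnMDl modn_small.
move/(congr1 (@odd_perm _)); rewrite odd_perm1 odd_permX odd_l /= => ->.
by [].
Qed.

(** Multiplication by [u] is an odd permutation of [Z/l]; by a theorem of Zolotarev
and Frobenius this says that the Jacobi symbol [(u/l)] is [-1], when [u] and [l]
are coprime and [l] is odd.  The existential makes it a total function of [u] and
[l]. *)
Definition scale_odd u l : bool :=
  [exists s : {perm 'I_l}, odd_perm s && [forall i, s i == u * i %% l :> nat]].

Lemma scale_oddE u l (s : {perm 'I_l}) :
  (forall i, s i = u * i %% l :> nat) -> scale_odd u l = s.
Proof.
move=> sE; apply/existsP/idP => [[t /andP[odd_t /forallP tE]] | odd_s].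
  by rewrite (_ : s = t) //; apply/permP=> i; apply/val_inj; rewrite /= sE -(eqP (tE i)).
by exists s; rewrite odd_s; apply/forallP=> i; apply/eqP.
Qed.

Lemma eq_scale_odd u u' l : u = u' %[mod l] -> scale_odd u l = scale_odd u' l.
Proof.
move=> uu'; apply: eq_existsb => s; congr (_ && _); apply: eq_forallb => i.
by rewrite -modnMml uu' modnMml.
Qed.

Lemma scale_odd1 l : scale_odd 1 l = false.
Proof.
rewrite (@scale_oddE 1 l 1) ?odd_perm1 // => i.
by rewrite perm1 mul1n modn_small.
Qed.

Lemma modn_digits r Y a b : r < a -> 0 < b ->
  (r + a * Y) %% (a * b) = (r + a * (Y %% b))%N.
Proof.
move=> lt_ra b0; have lt_ab : (r + a * (Y %% b) < a * b)%N.
  apply: (@leq_trans (a + a * (Y %% b))); first by rewrite ltn_add2r.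
  by rewrite -mulnS leq_mul2l ltn_mod b0 orbT.
rewrite {1}(divn_eq Y b) mulnDr addnCA mulnCA modnMDl modn_small //.
Qed.

(** Multiplicativity of the Jacobi symbol in its modulus, for odd [a] and [b] that
may have common factors.  On the digits [(i, j)] of [i + a * j], multiplication by
[u] modulo [a * b] maps [j] to [u * j] with a carry depending on [i], then [i] to
[u * i] modulo [a].  The carries are translations modulo [b], hence even, and the
two other maps act on an odd number of fibres. *)
Lemma scale_oddM u a b : odd a -> odd b -> coprime u (a * b) ->
  scale_odd u (a * b) = scale_odd u a (+) scale_odd u b.
Proof.
move=> odd_a odd_b co; have := co; rewrite coprimeMr => /andP[co_a co_b].
have [s sE] := exists_scale_perm co_a; have [t tE] := exists_scale_perm co_b.
have [w wE] := exists_scale_perm co.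
rewrite (scale_oddE sE) (scale_oddE tE) (scale_oddE wE).
have a0 : 0 < a by case: (a) odd_a.
have [sh shE even_sh] :=
  fin_all_exists2 (fun i : 'I_a => exists_shift_perm (u * i %/ a) odd_b).
(* [f1] acts on the high digit, carry included, and [f2] on the low digit. *)
pose f1 (z : 'I_a * 'I_b) := (z.1, (t * sh z.1) z.2).
have f1_inj : injective f1 by move=> [i j] [i' j'] [-> /perm_inj->].
pose f2 (z : 'I_a * 'I_b) := (s z.1, z.2).
have f2_inj : injective f2 by move=> [i j] [i' j'] [/perm_inj-> ->].
have odd1 : perm f1_inj = t :> bool.
  rewrite (@odd_perm_fibration _ 'I_a 'I_b fst pair (fun i => t * sh i) _ t) //.
  - by rewrite card_ord odd_a.
  - by move=> i j j' [].
  - by move=> [i j]; exists j.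
  - by move=> i j; rewrite permE.
  by move=> i; rewrite odd_permM (negPf (even_sh i)) addbF.
have odd2 : perm f2_inj = s :> bool.
  rewrite (@odd_perm_fibration _ 'I_b 'I_a snd (fun j i => (i, j)) (fun=> s) _ s) //.
  - by rewrite card_ord odd_b.
  - by move=> j i i' [].
  - by move=> [i j]; exists i.
  by move=> j i; rewrite permE.
have lt_phi (z : 'I_a * 'I_b) : z.1 + a * z.2 < a * b.
  case: z => i j /=; apply: leq_trans (_ : a * j.+1 <= _); last by rewrite leq_pmul2l.
  by rewrite mulnS ltn_add2r.
pose phi z : 'I_(a * b) := Ordinal (lt_phi z).
have phi_inj : injective phi.
  move=> [i j] [i' j'] /(congr1 val) /= e.
  have ei : i = i'.
    apply: val_inj; have /= := congr1 (modn^~ a) e.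
    by rewrite !(mulnC a) ![(_ + _ * a)%N]addnC !modnMDl !modn_small.
  congr (_, _) => //; apply/val_inj/eqP => /=.
  by move/eqP: e; rewrite ei eqn_add2l eqn_pmul2l.
rewrite addbC -odd1 -odd2 -odd_permM; apply: (odd_perm_extend phi_inj).
  move=> [i j]; apply: val_inj; rewrite /= wE permM !permE /= permM sE shE tE.
  have -> : (u * (i + a * j) = (u * i) %% a + a * (u * j + (u * i) %/ a))%N.
    rewrite mulnDr {1}(divn_eq (u * i) a) mulnCA mulnDr [(a * (_ %/ _))%N]mulnC.
    by rewrite -addnA addnC addnA.
  by rewrite modn_digits ?ltn_mod ?modnDml //; case: (b) odd_b.
move=> z; case/negP; apply/codomP.
have lt2 : z %/ a < b by rewrite ltn_divLR // [(b * a)%N]mulnC.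
exists (Ordinal (ltn_pmod z a0), Ordinal lt2); apply: val_inj => /=.
by rewrite addnC [(a * (_ %/ _))%N]mulnC; exact: divn_eq.
Qed.

Lemma scale_oddX u p e : odd p -> coprime u p ->
  scale_odd u (p ^ e) = odd e && scale_odd u p.
Proof.
move=> odd_p co; elim: e => [|e IHe].
  rewrite (@eq_scale_odd u 1) ?scale_odd1 // !modn1. 
  by [].
rewrite expnS scale_oddM ?oddX ?odd_p ?orbT // ?IHe /=.
  by case: (odd e); case: (scale_odd u p).
by rewrite coprimeMr co coprimeXr.
Qed.

(** A primitive root permutes the nonzero residues in a single cycle of even length. *)
Lemma prime_scale_odd p : prime p -> odd p -> exists2 r, coprime r p & scale_odd r p.
Proof.
move=> pr_p odd_p.
have /cyclicP[g gE] : cyclic [set: {unit 'F_p}] by apply: field_unit_group_cyclic.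
pose r : nat := val (FinRing.uval g).
have rE : (r%:R = FinRing.uval g :> 'F_p)%R by apply: natr_Zp.
have p1 := prime_gt1 pr_p; have p0 := prime_gt0 pr_p.
have gen i : 0 < i < p -> exists k, (i = r ^ k %% p)%N.
  case/andP=> i0 lt_ip; have ni : (i%:R != 0 :> 'F_p)%R.
    by rewrite -val_eqE /= val_Fp_nat // modn_small // -lt0n.
  have Ui : (i%:R : 'F_p)%R \is a GRing.unit by rewrite GRing.unitfE.
  have : FinRing.Unit Ui \in <[g]> by rewrite -gE inE.
  case/cycleP=> k /(congr1 val); rewrite FinRing.val_unitX /= -rE -GRing.natrX.
  move/(congr1 val); rewrite /= !val_Fp_nat // modn_small // => e.
  by exists k.
have r_p k : (r ^ k %% p != 0)%N.
  have : (r%:R ^+ k != 0 :> 'F_p)%R.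
    by rewrite GRing.expf_neq0 // rE -GRing.unitfE; apply: (valP g).
  by rewrite -GRing.natrX -val_eqE /= val_Fp_nat.
have co_r : coprime r p.
  rewrite coprime_sym prime_coprime // /dvdn; have := r_p 1%N; by rewrite expn1.
exists r => //.
have [s sE] := exists_scale_perm co_r; rewrite (scale_oddE sE).
pose one := Ordinal p1; have sX k : (s ^+ k) one = r ^ k %% p :> nat.
  elim: k => [|k IHk]; first by rewrite perm1 modn_small.
  by rewrite expgSr permM sE IHk modnMmr expnS.
have orb i : (i \in porbit s one) = (i != Ordinal p0).
  apply/porbitP/idP=> [[k ->] | i0].
    by rewrite -val_eqE /= sX.
  have [|k ik] := gen i; first by rewrite lt0n i0 ltn_ord.
  by exists k; apply: val_inj; rewrite /= sX.
rewrite (odd_perm_cycle (a := one)) => [|i]; last first.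
  rewrite orb negbK => /eqP->; apply: val_inj; rewrite /= sE /= muln0 mod0n.
  by [].
have -> : porbit s one = [set~ Ordinal p0] by apply/setP=> i; rewrite orb !inE.
rewrite cardsC1 card_ord. 
by have := odd_p; rewrite -{1}(prednK p0).
Qed.

(** If [p] divides [l] to an odd power and [l = m * p ^ e] with [m] prime to [p],
take a primitive root modulo [p] that is congruent to [1] modulo [m]. *)
Lemma nonsquare_scale_odd l : odd l -> ~~ perfect_square l ->
  exists2 u, coprime u l & scale_odd u l.
Proof.
move=> odd_l nsq; have l0 : 0 < l by case: (l) odd_l.
have [p lpl odd_e] : exists2 p, p \in primes l & odd (logn p l).
  apply/hasP; apply: contraR nsq => /hasPn sq; apply/existsP.
  pose k := (\prod_(p <- primes l) p ^ (logn p l)./2)%N.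
  have kE : (k ^ 2 = l)%N.
    rewrite [RHS](prod_prime_decomp l0) prime_decompE big_map /=.
    rewrite -mulnn -big_split /= big_seq [RHS]big_seq; apply: eq_bigr => p /sq even_p.
    by rewrite -expnD addnn even_halfK.
  have lt_k : k < l.+1.
    rewrite ltnS -kE -{1}[k]expn1 leq_pexp2l // lt0n.
    by apply: contraTneq l0 => k0; rewrite -kE k0.
  by exists (Ordinal lt_k); rewrite /= kE.
have pr_p : prime p by move: lpl; rewrite mem_primes => /andP[].
have p_l : p %| l by move: lpl; rewrite mem_primes => /and3P[].
have odd_p : odd p by apply: dvdn_odd p_l odd_l.
have [m co_pm lE] := pfactor_coprime pr_p l0.
have [r co_r odd_r] := prime_scale_odd pr_p odd_p.
pose u := chinese p m r 1.
have um : u = 1 %[mod m] by apply: chinese_modr.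
have up : u = r %[mod p] by apply: chinese_modl.
have co_up : coprime u p by rewrite -coprime_modl up coprime_modl.
have co_um : coprime u m by rewrite -coprime_modl um coprime_modl coprime1n.
have odd_m : odd m by move: odd_l; rewrite lE oddM => /andP[].
have co_ul : coprime u l by rewrite lE coprimeMr co_um coprimeXr.
exists u => //; rewrite {1}lE scale_oddM -?lE // ?oddX ?odd_p ?orbT // scale_oddX //.
by rewrite odd_e (eq_scale_odd um) scale_odd1 (eq_scale_odd up) odd_r.
Qed.

(** * Normalizers of centralizers *)

Lemma uniq_cent1_porbit (T : finType) (x h : {perm T}) z :
  uniq (cycle_type x) -> h \in 'C[x] -> porbit x (h z) = porbit x z.
Proof. by move=> /uniq_cycle_typeP uniq_x hx; apply/uniq_x/cent1_porbit_card. Qed.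

(** The cycles of [x] are the orbits of its centralizer, so a normalizing element
permutes them; and their sizes are distinct. *)
Lemma norm_cent1_porbit (T : finType) (x g : {perm T}) z :
  uniq (cycle_type x) -> g \in 'N('C[x]) -> porbit x (g z) = porbit x z.
Proof.
move=> uniq_x; have le g' u : g' \in 'N('C[x]) -> #|porbit x u| <= #|porbit x (g' u)|.
  move=> Ng; rewrite -(card_imset _ (@perm_inj _ g')); apply/subset_leq_card/subsetP.
  move=> _ /imsetP[_ /porbitP[i ->] ->].
  have Cxg : x ^ g' \in 'C[x] by rewrite memJ_norm ?cent1id.
  have e : forall v, g' (x v) = (x ^ g') (g' v) by move=> v; rewrite permJ.
  by rewrite (expg_permC e) -eq_porbit_mem uniq_cent1_porbit ?groupX.
move=> Ng; apply/(uniq_cycle_typeP _ uniq_x)/eqP; rewrite eqn_leq le // andbT.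
by rewrite -{2}(permK g z) le ?groupV.
Qed.

(** The conjugate of [x] by [g] is again in the centralizer, hence acts on the cycle
of [a] as some power [x ^+ u]. *)
Lemma norm_cent1_affine (T : finType) (x g : {perm T}) a :
    uniq (cycle_type x) -> g \in 'N('C[x]) ->
  exists u v, coprime u #|porbit x a| /\
    forall i, g ((x ^+ i) a) = (x ^+ (u * i + v)) a.
Proof.
move=> uniq_x Ng.
have [h Ch gx] : exists2 h : {perm T}, h \in 'C[x] & forall z, g (x z) = h (g z).
  by exists (x ^ g) => [|z]; rewrite ?permJ // memJ_norm ?cent1id.
have /porbitP[v gv] : g a \in porbit x a.
  by rewrite -eq_porbit_mem norm_cent1_porbit.
have /porbitP[u hu] : h (g a) \in porbit x (g a).
  by rewrite -eq_porbit_mem uniq_cent1_porbit.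
have gE i : g ((x ^+ i) a) = (x ^+ (u * i + v)) a.
  elim: i => [|i IHi]; first by rewrite muln0 perm1.
  rewrite expgSr permM gx IHi addnC expgD permM -gv.
  rewrite (expg_permC (cent1_permP _ _ Ch)) hu gv -!permM -!expgD.
  by rewrite mulnS [(v + _)%N]addnC.
exists u; exists v; split=> //; set l := #|porbit x a|.
have l0 : 0 < l by rewrite lt0n card_porbit_neq0.
(* If [d] were not [1], [g] would identify [x^(l/d) a] with [a]. *)
pose d := gcdn u l; have d0 : 0 < d by rewrite gcdn_gt0 l0 orbT.
have : g ((x ^+ (l %/ d)) a) = g ((x ^+ 0) a).
  apply/eqP; rewrite !gE expg_permE -/l muln0 eqn_modDr mod0n.
  rewrite -/(_ %| _) muln_divA ?dvdn_gcdr // -divn_mulAC ?dvdn_gcdl //.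
  exact: dvdn_mull.
move/perm_inj/eqP; rewrite expg_permE -/l mod0n -/(_ %| _) => dv.
have ld0 : 0 < l %/ d by rewrite divn_gt0 // dvdn_leq ?dvdn_gcdr.
have := dvdn_leq ld0 dv; rewrite leq_divRL // -{2}(muln1 l) leq_pmul2l //.
by rewrite /coprime -/d eqn_leq d0 andbT.
Qed.

(** On a cycle of length [k ^ 2] the multiplication by [u] has sign [(u/k)^2 = 1]. *)
Lemma norm_cent1_even (T : finType) (x g : {perm T}) :
    uniq (cycle_type x) -> all odd (cycle_type x) ->
    all perfect_square (cycle_type x) -> g \in 'N('C[x]) ->
  ~~ odd_perm g.
Proof.
move=> uniq_x odd_x sq_x Ng; have gO z := norm_cent1_porbit z uniq_x Ng.
rewrite (odd_perm_fibers gO) big1 // => O _; apply/negbTE; set S := [set _ | _].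
case: (set_0Vmem S) => [S0 | [a]].
  suff -> : restr_perm S g = 1 by rewrite odd_perm1.
  by apply/permP=> z; rewrite perm1 (out_perm (restr_perm_on _ _)) // S0 inE.
rewrite inE => /eqP aO; have {aO} SE : S = porbit x a.
  by apply/setP=> z; rewrite inE -aO eq_porbit_mem.
have [u [v [co_u gE]]] := norm_cent1_affine a uniq_x Ng.
move: co_u; set l := #|porbit x a| => co_u.
have l_x : l \in cycle_type x by apply: mem_cycle_type.
have odd_l : odd l := allP odd_x _ l_x.
have /existsP[[k _] /= /eqP kl] := allP sq_x _ l_x.
have [s sE] := exists_scale_perm co_u; have [t tE even_t] := exists_shift_perm v odd_l.
have even_s : ~~ odd_perm s.
  rewrite -(scale_oddE sE) -kl -mulnn scale_oddM ?addbb ?mulnn ?kl //.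
    by move: odd_l; rewrite -kl oddX.
  by move: odd_l; rewrite -kl oddX.
pose phi (i : 'I_l) := (x ^+ i) a.
have phi_mod m (i : 'I_l) : m %% l = i -> (x ^+ m) a = phi i.
  by move=> mi; apply/eqP; rewrite expg_permE -/l mi modn_small.
have phi_inj : injective phi.
  by move=> i j /eqP; rewrite expg_permE -/l !modn_small // => /eqP/val_inj.
suff -> : restr_perm S g = s * t :> bool.
  by rewrite odd_permM (negPf even_s) (negPf even_t).
apply: (odd_perm_extend phi_inj) => [i | z nz].
  rewrite restr_permE; first last.
  - by rewrite SE mem_porbit.
  - exact: fiber_norm.
  by rewrite gE; apply: phi_mod; rewrite permM tE sE modnDml.
apply: (out_perm (restr_perm_on _ _)); rewrite SE; apply: contra nz => /porbitP[i ->].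
have lt_i : i %% l < l by rewrite ltn_mod; apply: odd_gt0.
by rewrite (phi_mod i (Ordinal lt_i)) // codom_f.
Qed.

(** On a cycle whose length [l] is not a square, the map [x^i a |-> x^(u i) a],
extended by the identity, is odd for a suitable [u].  It conjugates an element of
the centralizer to one that agrees with it off this cycle and is a power of [x] on
it. *)
Lemma odd_norm_cent1 (T : finType) (x : {perm T}) :
    uniq (cycle_type x) -> all odd (cycle_type x) ->
    ~~ all perfect_square (cycle_type x) ->
  exists2 g, g \in 'N('C[x]) & odd_perm g.
Proof.
move=> uniq_x odd_x /allPn[_ /cycle_typeP[a ->]]; set l := #|porbit x a| => nsq.
have odd_l : odd l by apply: (allP odd_x); apply: mem_cycle_type.
have [u co_u odd_u] := nonsquare_scale_odd odd_l nsq.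
have [s sE] := exists_scale_perm co_u; rewrite (scale_oddE sE) in odd_u.
pose phi (i : 'I_l) := (x ^+ i) a.
have phi_mod m (i : 'I_l) : m %% l = i -> (x ^+ m) a = phi i.
  by move=> mi; apply/eqP; rewrite expg_permE -/l mi modn_small.
have phi_inj : injective phi.
  by move=> i j /eqP; rewrite expg_permE -/l !modn_small // => /eqP/val_inj.
have [g [g_phi g_out odd_g]] := extend_perm s phi_inj.
have gE i : g ((x ^+ i) a) = (x ^+ (u * i)) a.
  have lt_i : i %% l < l by rewrite ltn_mod; apply: odd_gt0.
  rewrite (phi_mod i (Ordinal lt_i)) // g_phi; apply/esym/phi_mod.
  by rewrite sE /= modnMmr.
have codom_phi z : (z \in codom phi) = (z \in porbit x a).
  apply/codomP/porbitP=> [[i ->] | [i ->]]; first by exists i.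
  have lt_i : i %% l < l by rewrite ltn_mod; apply: odd_gt0.
  by exists (Ordinal lt_i); apply: phi_mod.
have gfix z : z \notin porbit x a -> g z = z by rewrite -codom_phi; apply: g_out.
exists g; last by rewrite odd_g.
rewrite inE; apply/subsetP=> _ /imsetP[h Ch ->].
have hE := cent1_permP _ _ Ch.
have /porbitP[m ha] : h a \in porbit x a.
  by rewrite -eq_porbit_mem uniq_cent1_porbit.
have hgO i : (h ^ g) ((x ^+ (u * i)) a) = (x ^+ (u * m)) ((x ^+ (u * i)) a).
  rewrite -gE permJ (expg_permC hE) ha -[(x ^+ i) _]permM -expgD !gE mulnDr.
  by rewrite addnC expgD permM.
have hgN z : z \notin porbit x a -> (h ^ g) z = h z.
  move=> nz; rewrite -{1}(gfix z nz) permJ gfix //.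
  by rewrite -eq_porbit_mem uniq_cent1_porbit // eq_porbit_mem.
apply/cent1_permP=> z; case: (boolP (z \in porbit x a)) => [|nz]; last first.
  rewrite hgN ?hgN ?hE // -eq_porbit_mem.
  by rewrite (porbit_perm x 1) eq_porbit_mem.
have hg w : w \in porbit x a -> (h ^ g) w = (x ^+ (u * m)) w.
  move=> wO; have : g^-1 w \in porbit x a.
    by move: wO; apply: contraLR => nw; rewrite -{1}(permKV g w) gfix.
  by case/porbitP=> i wi; rewrite -(permKV g w) wi gE hgO.
move=> zO; rewrite !hg //; first by rewrite -!permM -expgS -expgSr.
by rewrite -eq_porbit_mem (porbit_perm x 1) eq_porbit_mem.
Qed.

(** This decides which classes of centralizers split in the alternating group.  The
normalizer contains the centralizer in the symmetric group, so the parts have to be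
distinct and odd, and then all the centralizer is even. *)
Lemma norm_altC_sub_Alt (T : finType) (x : {perm T}) :
  ('N(altC x) \subset 'Alt_T) = [&& uniq (cycle_type x), all odd (cycle_type x)
    & all perfect_square (cycle_type x)].
Proof.
have altC_id : 'C[x] \subset 'Alt_T -> altC x = 'C[x] by move/setIidPr.
apply/idP/and3P => [sNA | [uniq_x odd_x sq_x]]; last first.
  rewrite altC_id ?cent1_sub_Alt ?uniq_x //; apply/subsetP=> g Ng.
  by rewrite Alt_even (norm_cent1_even uniq_x).
have sCA : 'C[x] \subset 'Alt_T.
  apply: subset_trans sNA; apply: normsI (normG _).
  by apply: subset_trans (Alt_norm T); apply: subsetT.
have := sCA; rewrite cent1_sub_Alt => /andP[uniq_x odd_x]; split=> //.
apply/negPn/negP=> nsq; have [g Ng odd_g] := odd_norm_cent1 uniq_x odd_x nsq.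
by move/subsetP/(_ g): sNA; rewrite altC_id // Alt_even odd_g => /(_ Ng).
Qed.

(** * The counts *)

Lemma altCJ (T : finType) (x g : {perm T}) : altC (x ^ g) = altC x :^ g.
Proof.
rewrite /altC conjIg cent1J; congr (_ :&: _); apply/esym/normP.
by rewrite (subsetP (Alt_norm T)) ?inE.
Qed.

Lemma mem_Alt_cycle_type (T : finType) (x : {perm T}) :
  (x \in 'Alt_T) = (odd #|T| == odd (size (cycle_type x))).
Proof. by rewrite Alt_even odd_perm_cycle_type negb_add. Qed.

Lemma class_Sym_cycle_type (T : finType) (x y : {perm T}) :
  x ^: 'Sym_T = y ^: 'Sym_T <-> cycle_type x = cycle_type y.
Proof.
rewrite cycle_type_eqP; split=> [xy | [g ->]]; last by rewrite classGidl ?inE.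
have : y \in x ^: 'Sym_T by rewrite xy class_refl.
by case/imsetP=> g _ ->; exists g.
Qed.

Lemma orbit_altC_cycle_type (T : finType) (x y : {perm T}) :
    x \in 'Alt_T -> y \in 'Alt_T ->
    ~~ exceptional (cycle_type x) -> ~~ exceptional (cycle_type y) ->
  orbit 'Js 'Sym_T (altC x) = orbit 'Js 'Sym_T (altC y)
  <-> cycle_type x = cycle_type y.
Proof.
move=> Ax Ay ex ey; split=> [xy | /cycle_type_conj[g ->]].
  have : altC y \in orbit 'Js 'Sym_T (altC x) by rewrite xy orbit_refl.
  case/imsetP=> g _ /=; rewrite -altCJ => e; rewrite -(cycle_typeJ x g).
  have Axg : x ^ g \in 'Alt_T by rewrite Alt_even odd_permJ -Alt_even.
  by apply/esym/cycle_type_altC; rewrite ?cycle_typeJ.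
rewrite altCJ; apply/esym/orbit_eqP.
by apply/imsetP; exists g; rewrite ?inE.
Qed.

Lemma card_zclasses (gT : finGroupType) (G : {group gT}) :
  #|zclasses G| = #|(fun x => orbit 'Js G 'C_G[x]) @: G|.
Proof.
apply: card_imset_ker => x y Gx Gy.
have orbE : (orbit 'Js G 'C_G[x] = orbit 'Js G 'C_G[y]) <-> zconj G x y.
  split=> [xy | /existsP[g /andP[Gg /eqP <-]]].
    have : 'C_G[y] \in orbit 'Js G 'C_G[x] by rewrite xy orbit_refl.
    by case/imsetP=> g Gg e; apply/existsP; exists g; rewrite Gg e /= eqxx.
  by apply/esym/orbit_eqP/imsetP; exists g.
rewrite orbE; have zE := @zconj_equivalence _ G; split=> [/setP/(_ y) | xy].
  by rewrite !inE Gy; have [-> _] := zE y y y Gy Gy Gy.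
apply/setP=> z; rewrite !inE; case: (boolP (z \in G)) => //= Gz.
by have [_ ->] := zE x y z Gx Gy Gz.
Qed.

Lemma index_Alt n : 1 < n -> #|'Sym_('I_n) : 'Alt_('I_n)| = 2.
Proof. by move=> n1; rewrite Alt_index // card_ord. Qed.

(** The sign of a permutation of [m] points is the parity of [m] minus the number of
its cycles. *)
Definition even_type (m : nat) (s : seq nat) := odd m == odd (size s).

Lemma mem_Alt_even_type n (x : {perm 'I_n}) :
  (x \in 'Alt_('I_n)) = even_type n (cycle_type x).
Proof. by rewrite mem_Alt_cycle_type card_ord. Qed.

Lemma card_classes_Sym n : #|classes 'Sym_('I_n)| = p n.
Proof.
by apply: card_imset_cycle_type => [x|x y _ _];
  [rewrite inE | apply: class_Sym_cycle_type].
Qed.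

Lemma card_even_classes n :
  #|class^~ 'Sym_('I_n) @: 'Alt_('I_n)| = num_partitions (even_type n) n.
Proof.
apply: card_imset_cycle_type => [x|x y _ _]; first exact: mem_Alt_even_type.
exact: class_Sym_cycle_type.
Qed.

(** An even class of the symmetric group splits exactly when the centralizers of its
elements are contained in the alternating group. *)
Lemma card_classes_Alt_split n : 1 < n ->
  #|classes 'Alt_('I_n)| = (num_partitions (even_type n) n + q n)%N.
Proof.
move=> n1.
have actG : [acts 'Sym_('I_n), on 'Alt_('I_n) | 'J].
  by apply/actsP=> g _ x; rewrite /= !Alt_even odd_permJ.
have -> : #|classes 'Alt_('I_n)| = #|orbit 'J 'Alt_('I_n) @: 'Alt_('I_n)| by [].
rewrite (card_orbits_index2 (Alt_normal _) (index_Alt n1) actG); congr (_ + _)%N.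
  exact: card_even_classes.
apply: card_imset_cycle_type => [x|x y _ _]; last exact: class_Sym_cycle_type.
rewrite inE astab1J setTI cent1_sub_Alt andb_idl // => /andP[_].
exact: odd_cycle_type_Alt.
Qed.

Lemma card_classes_Alt n : 1 < n ->
  (p n + #|classes 'Alt_('I_n)| = 3 * num_partitions (even_type n) n)%N.
Proof.
move=> n1; rewrite -card_classes_Sym (classes_index2 (Alt_normal _) (index_Alt n1)).
by rewrite card_even_classes.
Qed.

(** Exceptional permutations can be discarded, for they contribute no new
centralizer; on the others the centralizer determines the type. *)
Lemma card_altC_orbits n :
  #|(fun x => orbit 'Js 'Sym_('I_n) (altC x)) @: 'Alt_('I_n)| =
  num_partitions (predI (even_type n) (predC exceptional)) n.
Proof.
have -> : (fun x => orbit 'Js 'Sym_('I_n) (altC x)) @: 'Alt_('I_n) =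
    (fun x => orbit 'Js 'Sym_('I_n) (altC x))
      @: [set x in 'Alt_('I_n) | ~~ exceptional (cycle_type x)].
  apply/setP=> X; apply/imsetP/imsetP=> -[x]; last first.
    by rewrite inE => /andP[Ax _] ->; exists x.
  move=> Ax ->; case: (boolP (exceptional (cycle_type x))) => [exc|nexc]; last first.
    by exists x; rewrite // inE Ax.
  have [y [Ay ey Cy]] := exceptional_altC exc.
  by exists y; rewrite ?Cy // inE Ay.
apply: card_imset_cycle_type => [x|x y]; first by rewrite in_set mem_Alt_even_type.
rewrite [x \in _]in_set [y \in _]in_set => /andP[Ax ex] /andP[Ay ey].
exact: orbit_altC_cycle_type.
Qed.

Lemma card_zclasses_Alt n : 1 < n ->
  #|zclasses 'Alt_('I_n)| =
  (num_partitions (predI (even_type n) (predC exceptional)) n + epsilon n)%N.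
Proof.
move=> n1.
rewrite card_zclasses -[RHS]/(_ + _)%N -card_altC_orbits.
have actG : [acts 'Sym_('I_n), on (@altC _) @: 'Alt_('I_n) | 'Js].
  apply/actsP=> g _ X; apply/imsetP/imsetP=> -[x Ax e].
    exists (x ^ g^-1); first by rewrite Alt_even odd_permJ -Alt_even.
    by rewrite altCJ -e /= -conjsgM mulgV conjsg1.
  by exists (x ^ g); [rewrite Alt_even odd_permJ -Alt_even | rewrite altCJ e].
have -> : (fun x => orbit 'Js 'Alt_('I_n) 'C_('Alt_('I_n))[x]) @: 'Alt_('I_n) =
    orbit 'Js 'Alt_('I_n) @: (@altC _ @: 'Alt_('I_n)).
  by rewrite -imset_comp.
rewrite (card_orbits_index2 (Alt_normal _) (index_Alt n1) actG) -imset_comp.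
congr (_ + _)%N.
have -> : [set w in (@altC _) @: 'Alt_('I_n)
             | 'C_('Sym_('I_n))[w | 'Js] \subset 'Alt_('I_n)] =
    (@altC _) @: [set x : {perm 'I_n} | [&& uniq (cycle_type x),
      all odd (cycle_type x) & all perfect_square (cycle_type x)]].
  apply/setP=> w; rewrite inE astab1Js setTI.
  apply/andP/imsetP=> [[/imsetP[x Ax ->]] | [x]].
    by rewrite norm_altC_sub_Alt => sq; exists x; rewrite ?inE.
  rewrite inE => sq ->; rewrite norm_altC_sub_Alt sq; split=> //.
  by apply: imset_f; case/and3P: sq => _ /odd_cycle_type_Alt.
rewrite -imset_comp; apply: card_imset_cycle_type => [x|x y]; first by rewrite inE.
have nexc (z : {perm 'I_n}) : uniq (cycle_type z) -> ~~ exceptional (cycle_type z).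
  by move=> uz; apply/and3P=> -[_ + _]; rewrite count_uniq_mem //; case: (_ \in _).
rewrite !inE => /and3P[ux ox _] /and3P[uy oy _].
by apply: orbit_altC_cycle_type; rewrite ?odd_cycle_type_Alt ?nexc.
Qed.

Lemma card_even_types n : 2 < n -> num_partitions (even_type n) n =
  (q_tilde (n - 3) + num_partitions (predI (even_type n) (predC exceptional)) n)%N.
Proof.
move=> n2; rewrite (num_partitionsID exceptional); congr (_ + _)%N.
rewrite -num_partitions_exceptional subnK //; apply: eq_num_partitions => s.
move=> /exists_cycle_type[x <-] /=; rewrite -mem_Alt_even_type andb_idl //.
by case/and3P=> /odd_cycle_type_Alt.
Qed.

Local Open Scope ring_scope.

Theorem corollary1p4 (n : nat) (hn : (4 <= n)%N) :
  #|classes 'Alt_('I_n)|%:R = ((p n)%:R + 3 * (q n)%:R) / 2 :> rat /\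
  #|zclasses 'Alt_('I_n)|%:R =
    #|classes 'Alt_('I_n)|%:R - ((q n)%:R + (q_tilde (n - 3))%:R)
      + (epsilon n)%:R :> rat.
Proof.
have n1 : (1 < n)%N by apply: leq_trans hn.
have n2 : (2 < n)%N by apply: leq_trans hn.
have castE (a b : nat) : a = b -> a%:R = b%:R :> rat by move->.
have := castE _ _ (card_classes_Alt n1); rewrite GRing.natrM GRing.natrD => E1.
have := castE _ _ (card_classes_Alt_split n1); rewrite GRing.natrD => E2.
have := castE _ _ (card_zclasses_Alt n1); rewrite GRing.natrD => E3.
have := castE _ _ (card_even_types n2); rewrite GRing.natrD => E4.
by split; lra.
Qed.
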